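(* Let $\gamma>-1$, $\beta\in\mathbb{D}$, and $\psi_{\beta,1}(w)=\frac{w-\beta}{1-\bar\beta w}$ for $w\in\mathbb{D}$. Suppose that the (bounded) composition operator $C_{\psi_{\beta,1}}$ on $A^2_\gamma(\mathbb{D})$ has the property that, for $w\in\mathbb{D}$, $\Im\{\widetilde{C_{\psi_{\beta,1}}}(w)\}=0$ implies $\Im\{\bar\beta w\}=0$. Then $\mathbf{Ber}(C_{\psi_{\beta,1}})$ is a convex subset of $\mathbb{C}$ if and only if $\beta=0$.
   Context: $\mathbb{D}$ is the open unit disk of $\mathbb{C}$; $dA$ is area measure on $\mathbb{D}$ normalized so that $\mathbb{D}$ has area $1$; $dA_\gamma(w)=(\gamma+1)(1-|w|^2)^\gamma dA(w)$. The weighted Bergman space $A^2_\gamma(\mathbb{D})$ is the Hilbert space of holomorphic functions $f$ on $\mathbb{D}$ with $\int_{\mathbb{D}}|f|^2dA_\gamma<\infty$, with inner product $\langle f,g\rangle=\int_{\mathbb{D}}f\bar g\,dA_\gamma$. Its normalized reproducing kernel at $\xi\in\mathbb{D}$ is $\hat k^\gamma_\xi(w)=\frac{(1-|\xi|^2)^{(\gamma+2)/2}}{(1-\bar\xi w)^{\gamma+2}}$ (principal branch of the power). For a holomorphic self-map $\psi$ of $\mathbb{D}$, the composition operator is $C_\psi f=f\circ\psi$. For a bounded linear operator $T$ on $A^2_\gamma(\mathbb{D})$, the Berezin transform is $\widetilde T(\xi)=\langle T\hat k^\gamma_\xi,\hat k^\gamma_\xi\rangle$, $\xi\in\mathbb{D}$,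 and the Berezin range is $\mathbf{Ber}(T)=\{\widetilde T(\xi):\xi\in\mathbb{D}\}$. $\Im$ denotes the imaginary part. *)

(* Defs.v *)
From HB Require Import structures.
From mathcomp Require Import all_boot all_order all_algebra.
From mathcomp Require Import all_classical all_reals all_analysis.
From mathcomp Require Import complex.

Set Implicit Arguments.
Unset Strict Implicit.
Unset Printing Implicit Defensive.

Import Order.TTheory GRing.Theory Num.Theory.
Import numFieldNormedType.Exports.

Local Open Scope classical_set_scope.
Local Open Scope complex_scope.
Local Open Scope ring_scope.

Section Defs.
Variable R : realType.
Local Notation C := R[i].

(* The norm [`|z|] of R[i] takes its values in R[i]; [cabs] is the same
   modulus as an element of R. *)
Definition cabs (z : C) : R := complex.Re `|z|.

Definition cexp (z : C) : C :=
  (expR (complex.Re z))%:C *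
  (cos (complex.Im z) +i* sin (complex.Im z)).

(* Principal argument, in ]-pi, pi] for z != 0. *)
Definition carg (z : C) : R :=
  let t := acos (complex.Re z / cabs z) in
  if 0 <= complex.Im z then t else - t.

Definition clog (z : C) : C := ln (cabs z) +i* carg z.

(* Principal branch of z^a; meaningful for z != 0 only. *)
Definition cpow (z : C) (a : R) : C := cexp (a%:C * clog z).

Definition unit_disk : set C := [set z | cabs z < 1].

(* The library's Lebesgue measure lives on R, so integrals over the disk are
   taken on R * R, identified with R[i] by (x, y) |-> x + iy. *)
Definition to_complex (p : R * R) : C := p.1 +i* p.2.

Definition plane_disk : set (R * R) := to_complex @^-1` unit_disk.

Local Notation plane_lebesgue :=
  (@lebesgue_measure R \x @lebesgue_measure R)%E.

Lemma disk_normalization_ge0 : 0 <= (fine (plane_lebesgue plane_disk))^-1.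
Proof. by rewrite invr_ge0 fine_ge0// measure_ge0. Qed.

(* Area measure, normalized so that the disk has measure 1. *)
Definition dA :=
  mscale (NngNum disk_normalization_ge0) plane_lebesgue.

(* Density of dA_gamma with respect to dA. *)
Definition weight (gamma : R) (w : C) : R :=
  (gamma + 1) * (1 - cabs w ^+ 2) `^ gamma.

(* Integral over the disk, with respect to dA_gamma, of a complex function. *)
Definition disk_integral (gamma : R) (h : C -> C) : C :=
  (\int[dA]_(p in plane_disk)
     (complex.Re (h (to_complex p)) * weight gamma (to_complex p))) +i*
  (\int[dA]_(p in plane_disk)
     (complex.Im (h (to_complex p)) * weight gamma (to_complex p))).

(* Functions on the disk are represented by total functions on R[i], of which
   only the values on the disk are used. R[i]^o is R[i] as a normed space over
   itself, so this is complex differentiability. *)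
Definition holomorphic_on_disk (f : C -> C) :=
  forall z, unit_disk z -> derivable (f : C^o -> C^o) z 1.

Definition bergman (gamma : R) : set (C -> C) :=
  [set f | holomorphic_on_disk f /\
    (\int[dA]_(p in plane_disk)
       (cabs (f (to_complex p)) ^+ 2 * weight gamma (to_complex p))%:E
     < +oo)%E].

Definition inner (gamma : R) (f g : C -> C) : C :=
  disk_integral gamma (fun w => f w * (g w)^*%C).

Definition bergman_norm (gamma : R) (f : C -> C) : R :=
  Num.sqrt (complex.Re (inner gamma f f)).

(* T is a bounded linear operator on A^2_gamma. The first conjunct says that T
   acts on functions on the disk, whatever their values elsewhere. *)
Definition bounded_operator (gamma : R) (T : (C -> C) -> C -> C) :=
  [/\ forall f g, bergman gamma f -> bergman gamma g ->
        {in unit_disk, f =1 g} -> {in unit_disk, T f =1 T g},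
      forall f, bergman gamma f -> bergman gamma (T f),
      forall (a : C) f g, bergman gamma f -> bergman gamma g ->
        {in unit_disk, T (fun w => a * f w + g w) =1
                       (fun w => a * T f w + T g w)} &
      exists M : R, forall f, bergman gamma f ->
        bergman_norm gamma (T f) <= M * bergman_norm gamma f].

Definition normalized_kernel (gamma : R) (xi : C) : C -> C := fun w =>
  ((1 - cabs xi ^+ 2) `^ ((gamma + 2) / 2))%:C /
  cpow (1 - xi^*%C * w) (gamma + 2).

Definition composition (psi : C -> C) : (C -> C) -> C -> C :=
  fun f => f \o psi.

Definition berezin (gamma : R) (T : (C -> C) -> C -> C) (xi : C) : C :=
  inner gamma (T (normalized_kernel gamma xi)) (normalized_kernel gamma xi).

Definition berezin_range (gamma : R) (T : (C -> C) -> C -> C) : set C :=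
  berezin gamma T @` unit_disk.

Definition disk_moebius (beta : C) : C -> C :=
  fun w => (w - beta) / (1 - beta^*%C * w).

(* The real vector space structure of R[i] is carried by its alias
   [Rcomplex R]. *)
Definition real_convex (A : set C) : Prop :=
  @convex_set R (Rcomplex R) A.

End Defs.

(* Main.v *)
(** By the reproducing property, with p = gamma + 2, the Berezin transform of
    the composition operator is ((1 - |xi|^2) / (1 - conj(xi) psi(xi)))^p, where
    1 - conj(xi) psi(xi) = (1 - |xi|^2 - 2i Im z) / (1 - z) for
    z = conj(beta) xi.  If beta <> 0, reflecting xi in the line R beta
    conjugates the transform, so a convex Berezin range contains its own real
    parts.  By hypothesis a real value is attained at a point where z is real,
    where it equals (1 - z)^p >= (1 - |beta|)^p.  But at xi = i t beta / |beta|
    the transform tends to 0 as t -> 1, a contradiction.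

    The reproducing property is proved for uniform limits of polynomials on the
    disk, a class that contains the kernel composed with psi.  Expanding the
    kernel by the binomial series reduces it to the monomials, which are
    orthogonal because Lebesgue measure is rotation invariant, and whose norms
    follow from the fact that |w|^2 is uniformly distributed on [0, 1]. *)
Require Import Defs.
From mathcomp Require Import all_boot all_order all_algebra.
From mathcomp Require Import all_classical all_reals all_analysis.
From mathcomp Require Import measurable_realfun.
From mathcomp Require Import complex.
From mathcomp Require Import ring lra.

Import Order.TTheory GRing.Theory Num.Theory.
Local Open Scope ring_scope.

(** * Complex powers and the binomial series *)

(** The principal power is differentiated only along the segments t -> 1 - t z with |z| < 1, which
    stay in the right half-plane. The product of (1 - t z)^p with a partial sum of the series of (1
    - t z)^-p has a derivative reduced to a single remainder term, so the mean value theorem gives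
    an explicit error, uniform on |z| <= r < 1. Uniformity is what approximation by polynomials asks
    for. Since all functions involved are bounded on the disk, integrability reduces to that of the
    weight, which holds for gamma > -1 even when the weight blows up at the circle.

    The Berezin transform depends on xi only through |xi| and z = conj(beta) xi. The reflection
    keeps |xi| and conjugates z, hence conjugates the transform. On the line perpendicular to beta,
    z is imaginary and stays away from 0 near the circle: the denominator 1 - conj(xi) psi(xi) is
    then bounded below while 1 - |xi|^2 vanishes. A single explicit point of that line suffices for
    the contradiction. *)

Section ComplexModulus.
Context {R : realType}.
Local Open Scope complex_scope.
Local Notation C := R[i].
Implicit Types (z w : C) (x y a : R).

Lemma RecD z w : complex.Re (z + w) = complex.Re z + complex.Re w.
Proof. by case: z; case: w. Qed.

Lemma ImcD z w : complex.Im (z + w) = complex.Im z + complex.Im w.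
Proof. by case: z; case: w. Qed.

Lemma RecN z : complex.Re (- z) = - complex.Re z.
Proof. by case: z. Qed.

Lemma ImcN z : complex.Im (- z) = - complex.Im z.
Proof. by case: z. Qed.

Lemma RecM z w : complex.Re (z * w) =
  complex.Re z * complex.Re w - complex.Im z * complex.Im w.
Proof. by case: z; case: w. Qed.

Lemma ImcM z w : complex.Im (z * w) =
  complex.Re z * complex.Im w + complex.Im z * complex.Re w.
Proof. by case: z; case: w. Qed.

Lemma Re_realM x z : complex.Re (x%:C * z) = x * complex.Re z.
Proof. by rewrite RecM mul0r subr0. Qed.

Lemma Im_realM x z : complex.Im (x%:C * z) = x * complex.Im z.
Proof. by rewrite ImcM mul0r addr0. Qed.

Lemma real_complexD x y : (x + y)%:C = x%:C + y%:C.
Proof. exact: rmorphD. Qed.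

Lemma real_complexM x y : (x * y)%:C = x%:C * y%:C.
Proof. exact: rmorphM. Qed.

Lemma real_complexX x n : (x ^+ n)%:C = x%:C ^+ n.
Proof. exact: rmorphXn. Qed.

Lemma conjcD z w : (z + w)^*%C = z^*%C + w^*%C.
Proof. exact: rmorphD. Qed.

Lemma conjcB z w : (z - w)^*%C = z^*%C - w^*%C.
Proof. exact: rmorphB. Qed.

Lemma conjcM z w : (z * w)^*%C = z^*%C * w^*%C.
Proof. exact: rmorphM. Qed.

Lemma cabsE z : cabs z = Normc.normc z.
Proof. by case: z. Qed.

Lemma norm_cabs z : `|z| = (cabs z)%:C.
Proof. by case: z. Qed.

Lemma cabs_sqr z : cabs z ^+ 2 = complex.Re z ^+ 2 + complex.Im z ^+ 2.
Proof. by case: z => x y; rewrite cabsE /= sqr_sqrtr// addr_ge0// sqr_ge0. Qed.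

Lemma cabs_ge0 z : 0 <= cabs z.
Proof. by case: z => x y; rewrite cabsE /= sqrtr_ge0. Qed.

Lemma cabsM z w : cabs (z * w) = cabs z * cabs w.
Proof. by rewrite !cabsE Normc.normcM. Qed.

Lemma cabsV z : cabs z^-1 = (cabs z)^-1.
Proof. by rewrite !cabsE Normc.normcV. Qed.

Lemma cabsX z n : cabs (z ^+ n) = cabs z ^+ n.
Proof.
elim: n => [|n IH]; first by rewrite !expr0 cabsE Normc.normc1.
by rewrite !exprS cabsM IH.
Qed.

Lemma cabsD z w : cabs (z + w) <= cabs z + cabs w.
Proof. by rewrite -lecR rmorphD/= -!norm_cabs ler_normD. Qed.

Lemma cabsN z : cabs (- z) = cabs z.
Proof. by apply: complexI; rewrite -!norm_cabs normrN. Qed.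

Lemma cabs_distC z w : cabs (z - w) = cabs (w - z).
Proof. by rewrite -cabsN opprB. Qed.

Lemma cabs0 : cabs (0 : C) = 0.
Proof. by rewrite cabsE Normc.normc0. Qed.

Lemma cabs1 : cabs (1 : C) = 1.
Proof. by rewrite cabsE Normc.normc1. Qed.

Lemma cabs_eq0 z : (cabs z == 0) = (z == 0).
Proof. by rewrite -(normr_eq0 z) norm_cabs eq_complex/= eqxx andbT. Qed.

Lemma cabs_gt0 z : (0 < cabs z) = (z != 0).
Proof. by rewrite lt_def cabs_ge0 andbT cabs_eq0. Qed.

Lemma cabs_conj z : cabs z^*%C = cabs z.
Proof. by case: z => x y; rewrite !cabsE /= sqrrN. Qed.

Lemma cabs_real x : cabs x%:C = `|x|.
Proof. by rewrite cabsE /= expr0n/= addr0 sqrtr_sqr. Qed.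

Lemma Re_le_cabs z : `|complex.Re z| <= cabs z.
Proof. by rewrite -lecR -norm_cabs normc_ge_Re. Qed.

Lemma Im_le_cabs z : `|complex.Im z| <= cabs z.
Proof.
rewrite -(@ler_pXn2r _ 2) ?nnegrE ?cabs_ge0// cabs_sqr.
by rewrite real_normK ?num_real// lerDr sqr_ge0.
Qed.

(** Source of the factor 2 in [cderive_bound] and [disk_integral_le], where real and imaginary parts
    are estimated separately; the later limit arguments absorb it. *)
Lemma cabs_le z : cabs z <= `|complex.Re z| + `|complex.Im z|.
Proof.
rewrite -(@ler_pXn2r _ 2) ?nnegrE ?cabs_ge0 ?addr_ge0// cabs_sqr sqrrD.
rewrite !real_normK ?num_real// -addrA lerD2l lerDr.
by rewrite mulrn_wge0// mulr_ge0.
Qed.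

Lemma cabs_sum I (r : seq I) (P : pred I) (F : I -> C) :
  cabs (\sum_(i <- r | P i) F i) <= \sum_(i <- r | P i) cabs (F i).
Proof.
elim/big_rec2: _ => [|i y z _ IH]; first by rewrite cabs0.
by apply: le_trans (cabsD _ _) _; rewrite lerD2l.
Qed.

Lemma cabs1B_ge z : 1 - cabs z <= cabs (1 - z).
Proof. by rewrite lerBlDr -{1}cabs1 -{1}(subrK z 1) cabsD. Qed.

Lemma cabs1B_gt0 z : cabs z < 1 -> 0 < cabs (1 - z).
Proof. by move=> z1; apply: lt_le_trans (cabs1B_ge z); rewrite subr_gt0. Qed.

Lemma oneB_neq0 z : cabs z < 1 -> 1 - z != 0.
Proof. by move=> z1; rewrite -cabs_gt0 cabs1B_gt0. Qed.

Lemma Re1B_gt0 z : cabs z < 1 -> 0 < complex.Re (1 - z).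
Proof.
case: z => x y z1; rewrite /= subr_gt0; apply: le_lt_trans z1.
exact: le_trans (ler_norm _) (Re_le_cabs (x +i* y)).
Qed.

Lemma cabsM_lt1 z w : cabs z < 1 -> cabs w < 1 -> cabs (z * w) < 1.
Proof. by move=> z1 w1; rewrite cabsM mulr_ilt1 ?cabs_ge0. Qed.

End ComplexModulus.

(** * Modulus, argument and conjugation of principal powers *)

Section ComplexPower.
Context {R : realType}.
Local Open Scope complex_scope.
Local Notation C := R[i].
Implicit Types (z w : C) (x y a : R).

Lemma cexpE x y : cexp (x +i* y) = (expR x)%:C * (cos y +i* sin y).
Proof. by []. Qed.

Lemma cabs_cexp z : cabs (cexp z) = expR (complex.Re z).
Proof.
case: z => x y; rewrite cexpE cabsM cabs_real ger0_norm ?expR_ge0//.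
by rewrite cabsE /= cos2Dsin2 sqrtr1 mulr1.
Qed.

Lemma cpowE z a : cpow z a = cexp ((a * ln (cabs z)) +i* (a * carg z)).
Proof. by rewrite /cpow /clog; congr cexp; simpc. Qed.

Lemma cabs_cpow z a : z != 0 -> cabs (cpow z a) = cabs z `^ a.
Proof.
by move=> z0; rewrite cpowE cabs_cexp /= /powR cabs_eq0 (negbTE z0).
Qed.

Lemma cpow_neq0 z a : z != 0 -> cpow z a != 0.
Proof.
by move=> z0; rewrite -cabs_gt0 cabs_cpow// powR_gt0// cabs_gt0.
Qed.

(** For Re z > 0 the [acos] in [carg] is the angle in [0, pi/2) with tangent |Im z| / Re z, by the
    formula for cos (atan u); the lower half follows by conjugation. One formula thus replaces the
    case split of [carg]. *)
Lemma carg_atan z : 0 < complex.Re z ->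
  carg z = atan (complex.Im z / complex.Re z).
Proof.
case: z => x y /= x0.
have key v : 0 <= v -> acos (x / cabs (x +i* v)) = atan (v / x).
  move=> v0; rewrite -[RHS]cosK; last first.
    rewrite in_itv/=; apply/andP; split.
      by rewrite -atan0 le_atan// divr_ge0// ltW.
    apply: le_trans (ltW (atan_ltpi2 _)) _.
    by rewrite ler_pdivrMr// ler_peMr// ?pi_ge0// ler1n.
  congr acos; rewrite cos_atan cabsE/=.
  have -> : x ^+ 2 + v ^+ 2 = x ^+ 2 * (1 + (v / x) ^+ 2).
    by field; rewrite gt_eqF.
  rewrite sqrtrM ?sqr_ge0// sqrtr_sqr gtr0_norm// invfM mulrA divff ?mul1r//.
  by rewrite gt_eqF.
rewrite /carg /=; case: ifPn => [y0|]; first exact: key.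
rewrite -ltNge => y0.
have -> : cabs (x +i* y) = cabs (x +i* (- y)) by rewrite -cabs_conj.
by rewrite key ?oppr_ge0 ?ltW// mulNr atanN opprK.
Qed.

(** [atan] is odd, so conjugation negates the argument. The right half-plane keeps clear of the
    negative axis, where the principal argument is pi on both sides of the conjugation. *)
Lemma cpow_conj z a : 0 < complex.Re z -> cpow z^*%C a = (cpow z a)^*%C.
Proof.
move=> z0; rewrite !cpowE cabs_conj !carg_atan//; last by case: z z0.
case: z z0 => x y /= x0; rewrite mulNr atanN mulrN !cexpE cosN sinN.
by simpc.
Qed.

Lemma cpow_real x a : 0 < x -> cpow x%:C a = (x `^ a)%:C.
Proof.
move=> x0; rewrite cpowE carg_atan//= mul0r atan0 mulr0 cexpE cos0 sin0.
by rewrite cabs_real gtr0_norm// mulr1 /powR gt_eqF.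
Qed.

End ComplexPower.

(** * Derivatives of complex functions of a real variable *)

Section ComplexDerivative.
Context {R : realType}.
Local Open Scope complex_scope.
Local Open Scope classical_set_scope.
Local Notation C := R[i].
Import numFieldNormedType.Exports.
Implicit Types (f g : R -> C) (df dg c : C) (t : R).

(** Taken componentwise, so that each rule reduces to the real one. *)
Definition is_cderive f t df : Prop :=
  is_derive t 1 (fun s => complex.Re (f s)) (complex.Re df) /\
  is_derive t 1 (fun s => complex.Im (f s)) (complex.Im df).

Lemma is_cderive_eq f t df dg : is_cderive f t df -> df = dg ->
  is_cderive f t dg.
Proof. by move=> ? <-. Qed.

Lemma is_cderive_cst c t : is_cderive (fun=> c) t 0.
Proof. by split; exact: is_derive_cst. Qed.

Lemma is_cderiveD f g t df dg : is_cderive f t df -> is_cderive g t dg ->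
  is_cderive (fun s => f s + g s) t (df + dg).
Proof.
move=> [f1 f2] [g1 g2]; split.
- rewrite (_ : (fun s => _) = (fun s => complex.Re (f s)) +
    (fun s => complex.Re (g s))); first by rewrite RecD; exact: is_deriveD.
  by apply/funext => s; rewrite RecD.
- rewrite (_ : (fun s => _) = (fun s => complex.Im (f s)) +
    (fun s => complex.Im (g s))); first by rewrite ImcD; exact: is_deriveD.
  by apply/funext => s; rewrite ImcD.
Qed.

Lemma is_cderiveM f g t df dg : is_cderive f t df -> is_cderive g t dg ->
  is_cderive (fun s => f s * g s) t (df * g t + f t * dg).
Proof.
move=> [f1 f2] [g1 g2]; split.
- rewrite (_ : (fun s => _) =
    (fun s => complex.Re (f s)) * (fun s => complex.Re (g s)) -
    (fun s => complex.Im (f s)) * (fun s => complex.Im (g s))); last first.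
    by apply/funext => s; rewrite RecM.
  by apply: is_derive_eq; rewrite /GRing.scale/= RecD !RecM; ring.
- rewrite (_ : (fun s => _) =
    (fun s => complex.Re (f s)) * (fun s => complex.Im (g s)) +
    (fun s => complex.Im (f s)) * (fun s => complex.Re (g s))); last first.
    by apply/funext => s; rewrite ImcM.
  by apply: is_derive_eq; rewrite /GRing.scale/= ImcD !ImcM; ring.
Qed.

Lemma is_cderive_real (h : R -> R) t (dh : R) : is_derive t 1 h dh ->
  is_cderive (fun s => (h s)%:C) t dh%:C.
Proof. by split => //=; exact: is_derive_cst. Qed.

Lemma is_cderive_cexp f t df : is_cderive f t df ->
  is_cderive (fun s => cexp (f s)) t (df * cexp (f t)).
Proof.
move=> [f1 f2].
pose E := expR \o (fun s => complex.Re (f s)).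
have dE : is_derive t 1 E (expR (complex.Re (f t)) * complex.Re df).
  exact: is_derive1_comp.
pose Ci := cos \o (fun s => complex.Im (f s)).
have dC : is_derive t 1 Ci (- sin (complex.Im (f t)) * complex.Im df).
  exact: is_derive1_comp.
pose S := sin \o (fun s => complex.Im (f s)).
have dS : is_derive t 1 S (cos (complex.Im (f t)) * complex.Im df).
  exact: is_derive1_comp.
split.
- rewrite (_ : (fun s => _) = E * Ci); last first.
    by apply/funext => s /=; rewrite /E /Ci /= mul0r subr0.
  apply: is_derive_eq; rewrite /GRing.scale/= /E /Ci /=.
  by case: df {f1 f2 dE dC dS} => a b /=; ring.
- rewrite (_ : (fun s => _) = E * S); last first.
    by apply/funext => s /=; rewrite /E /S /= mul0r addr0.
  apply: is_derive_eq; rewrite /GRing.scale/= /E /S /=.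
  by case: df {f1 f2 dE dC dS} => a b /=; ring.
Qed.

(** The mean value theorem fails for complex values; it is applied to each component, with a
    different intermediate point, at the cost of a factor 2. *)
Lemma cderive_bound f (df : R -> C) (K : R) :
  (forall t, 0 <= t <= 1 -> is_cderive f t (df t)) ->
  (forall t, 0 <= t <= 1 -> cabs (df t) <= K) ->
  cabs (f 1 - f 0) <= 2 * K.
Proof.
move=> dfE dfK.
have key (h dh : R -> R) : (forall t, 0 <= t <= 1 -> is_derive t 1 h (dh t)) ->
    (forall t, 0 <= t <= 1 -> `|dh t| <= K) -> `|h 1 - h 0| <= K.
  move=> dhE dhK.
  have [|||t t01 ->] := @MVT_segment R h dh 0 1.
  - exact: ler01.
  - by move=> t; rewrite in_itv/= => /andP[t0 t1]; apply: dhE; rewrite !ltW.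
  - apply: derivable_within_continuous => t; rewrite in_itv/= => t01.
    by have := dhE _ t01; move=> ?; exact: ex_derive.
  - by rewrite subr0 mulr1; apply: dhK; move: t01; rewrite in_itv.
apply: le_trans (cabs_le _) _.
rewrite RecD ImcD RecN ImcN.
rewrite mulr_natl mulr2n; apply: lerD.
- apply: (key (fun s => complex.Re (f s)) (fun s => complex.Re (df s))).
    by move=> t /dfE[].
  by move=> t /dfK; apply: le_trans; exact: Re_le_cabs.
- apply: (key (fun s => complex.Im (f s)) (fun s => complex.Im (df s))).
    by move=> t /dfE[].
  by move=> t /dfK; apply: le_trans; exact: Im_le_cabs.
Qed.

(* On the right half-plane [carg] is the arctangent of Im / Re, which is
   smooth, so that the logarithm may be differentiated along a segment. *)
Lemma is_cderive_log1B (z : C) (t : R) : complex.Re (1 - t%:C * z) != 0 ->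
  is_cderive (fun s => let w := 1 - s%:C * z in
     (2^-1 * ln (complex.Re w ^+ 2 + complex.Im w ^+ 2)) +i*
     atan (complex.Im w / complex.Re w)) t (- z / (1 - t%:C * z)).
Proof.
have eR (s : R) : complex.Re (1 - s%:C * z) = 1 - s * complex.Re z.
  by rewrite RecD RecN Re_realM.
have eI (s : R) : complex.Im (1 - s%:C * z) = - (s * complex.Im z).
  by rewrite ImcD ImcN Im_realM/= sub0r.
rewrite eR; set x := complex.Re z in eR *; set y := complex.Im z in eI * => h.
have ReQ : complex.Re (- z / (1 - t%:C * z)) =
    (- x * (1 - t * x) + t * y ^+ 2) / ((1 - t * x) ^+ 2 + (- (t * y)) ^+ 2).
  rewrite RecM RecN ImcN -/x -/y.
  case: (1 - t%:C * z) (eR t) (eI t) => a b /= -> ->; ring.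
have ImQ : complex.Im (- z / (1 - t%:C * z)) =
    - y / ((1 - t * x) ^+ 2 + (- (t * y)) ^+ 2).
  rewrite ImcM RecN ImcN -/x -/y.
  case: (1 - t%:C * z) (eR t) (eI t) => a b /= -> ->; ring.
have Dx : is_derive t 1 (fun s : R => 1 - s * x) (- x).
  rewrite (_ : (fun s => _) = cst 1 - (x *: id)); last first.
    by apply/funext => s; rewrite /= mulrC.
  by apply: is_derive_eq; rewrite /GRing.scale/=; ring.
have Dy : is_derive t 1 (fun s : R => - (s * y)) (- y).
  rewrite (_ : (fun s => _) = - (y *: id)); last first.
    by apply/funext => s; rewrite /= mulrC.
  by apply: is_derive_eq; rewrite /GRing.scale/=; ring.
have N0 : 0 < (1 - t * x) ^+ 2 + (- (t * y)) ^+ 2.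
  by rewrite ltr_pwDl// ?sqr_ge0// exprn_even_gt0.
have eqN : (1 - t * x) ^+ 2 + (- (t * y)) ^+ 2 != 0 by rewrite gt_eqF.
split; rewrite ?ReQ ?ImQ.
- pose N : R -> R := (fun s : R => 1 - s * x) ^+ 2 +
    (fun s : R => - (s * y)) ^+ 2.
  have DN : is_derive t 1 N
    (- x * (1 - t * x) *+ 2 + - y * - (t * y) *+ 2).
    apply: is_derive_eq; rewrite /GRing.scale/=; ring.
  rewrite (_ : (fun s => _) = 2^-1 *: (@ln R \o N)); last first.
    by apply/funext => s /=; rewrite eR eI.
  have DL := @is_derive1_comp _ (@ln R) N t _ _ (@is_derive1_ln R (N t) N0) DN.
  apply: is_derive_eq; rewrite /GRing.scale/=.
  have -> : N t = (1 - t * x) ^+ 2 + (- (t * y)) ^+ 2 by [].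
  by field; move: eqN.
- pose q : R -> R := (fun s : R => - (s * y)) * (fun s : R => (1 - s * x)^-1).
  have Dq : is_derive t 1 q
      (- (t * y) * - (1 - t * x) ^- 2 * - x + (1 - t * x)^-1 * - y).
    have ? := @is_deriveV _ (fun s : R => 1 - s * x) t _ _ h Dx.
    by apply: is_derive_eq; rewrite /GRing.scale/=; ring.
  rewrite (_ : (fun s => _) = @atan R \o q); last first.
    by apply/funext => s /=; rewrite eR eI.
  have DL := @is_derive1_comp _ (@atan R) q t _ _ (is_derive1_atan (q t)) Dq.
  apply: is_derive_eq.
  have -> : q t = - (t * y) / (1 - t * x) by [].
  have e : 1 + (- (t * y) / (1 - t * x)) ^+ 2 =
    ((1 - t * x) ^+ 2 + (- (t * y)) ^+ 2) / (1 - t * x) ^+ 2 by field.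
  by rewrite [X in X^-1]e; field; rewrite h eqN.
Qed.

End ComplexDerivative.

(** * Partial sums of the binomial series and their error *)

Section BinomialSeries.
Context {R : realType}.
Local Open Scope complex_scope.
Local Open Scope classical_set_scope.
Local Notation C := R[i].
Import numFieldNormedType.Exports.
Implicit Types (z : C) (p r t : R) (n N : nat).

(* Taylor coefficients of (1 - z)^-p. *)
Definition binc p n : R := \prod_(k < n) ((k%:R + p) / k.+1%:R).

Definition binsum p N z : C := \sum_(n < N) (binc p n)%:C * z ^+ n.

(** The t-derivative of [binsum p N (t z)]. At n = 0 the factor [n%:R] neutralizes the truncated
    exponent [n.-1]. *)
Definition dbinsum p N z t : C :=
  \sum_(n < N) (binc p n * (n%:R * t ^+ n.-1))%:C * z ^+ n.

Lemma binc0 p : binc p 0 = 1.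
Proof. by rewrite /binc big_ord0. Qed.

Lemma bincS p n : binc p n.+1 = binc p n * ((n%:R + p) / n.+1%:R).
Proof. by rewrite /binc big_ord_recr. Qed.

Lemma binc_ge0 p n : 0 <= p -> 0 <= binc p n.
Proof.
by move=> p0; apply: prodr_ge0 => k _; rewrite divr_ge0// addr_ge0.
Qed.

Lemma is_cderive_binsum p N z t :
  is_cderive (fun s => binsum p N (s%:C * z)) t (dbinsum p N z t).
Proof.
elim: N => [|N IH].
  rewrite /dbinsum big_ord0 (_ : (fun s => _) = fun=> 0).
    exact: is_cderive_cst.
  by apply/funext => s; rewrite /binsum big_ord0.
rewrite /dbinsum big_ord_recr/= (_ : (fun s => _) =
    fun s => binsum p N (s%:C * z) + (s ^+ N)%:C * ((binc p N)%:C * z ^+ N)).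
  apply: is_cderiveD; first exact: IH.
  apply: is_cderive_eq.
    apply: is_cderiveM; last exact: is_cderive_cst.
    apply: (@is_cderive_real R (fun s => s ^+ N) t (N%:R * t ^+ N.-1)).
    rewrite (_ : (fun s => _) = (@id R) ^+ N); last first.
      by apply/funext => s; elim: N {IH} => // N IH; rewrite !exprS IH.
    apply: is_derive_eq; rewrite /GRing.scale/=; rewrite mulr1.
    by congr (_ * _).
  by rewrite mulr0 addr0 !rmorphM /= mulrCA mulrA.
apply/funext => s; rewrite /binsum big_ord_recr/=; congr (_ + _).
by rewrite exprMn rmorphXn/= mulrCA.
Qed.

(** The full series S satisfies (1 - t z) S' = p z S. For a partial sum the relation (n + 1) c_(n+1)
    = (n + p) c_n cancels everything but the last term. *)
Lemma binsum_ode p N z t :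
  (1 - t%:C * z) * dbinsum p N.+1 z t = p%:C * z * binsum p N.+1 (t%:C * z) -
    z * ((N%:R + p) * binc p N * t ^+ N)%:C * z ^+ N.
Proof.
elim: N => [|N IH].
  rewrite /dbinsum /binsum !big_ord_recr !big_ord0/= binc0 !expr0.
  rewrite !(mul0r, mulr0, mulr1, add0r, rmorph0, rmorph1).
  by rewrite [z * _]mulrC subrr.
rewrite /dbinsum big_ord_recr/= -/(dbinsum _ _ _ _) mulrDr IH.
rewrite /binsum [in RHS]big_ord_recr/= -/(binsum p N.+1 _).
have e : binc p N.+1 * N.+1%:R = binc p N * (N%:R + p).
  by rewrite bincS -mulrA divfK// pnatr_eq0.
have -> : (N%:R + p) * binc p N * t ^+ N = binc p N.+1 * N.+1%:R * t ^+ N.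
  by rewrite e; ring.
rewrite exprMn !(real_complexM, real_complexD, real_complexX) !exprS.
by ring.
Qed.

(** G(t) = (1 - t z)^p S(t z) equals 1 at t = 0, and by [binsum_ode] its derivative keeps only the
    truncation term. In the bound of G', 2^p comes from |1 - t z| <= 2, 1 / (1 - r) from |1 - t z|
    >= 1 - r, and a spare factor |z| is discarded. *)
Lemma binsum_bound p r N z : 0 < p -> r < 1 -> cabs z <= r ->
  cabs (cpow (1 - z) p * binsum p N.+1 z - 1) <=
  2 * (2 `^ p / (1 - r) * ((N%:R + p) * binc p N * r ^+ N)).
Proof.
move=> p0 r1 zr.
have r0 : 0 <= r := le_trans (cabs_ge0 z) zr.
(* The same formula serves for every real s, so [E] is differentiated without looking for a
   neighbourhood where it agrees with [cpow]; the two are compared on [0, 1] only. *)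
pose L (s : R) : C := let w := 1 - s%:C * z in
     (2^-1 * ln (complex.Re w ^+ 2 + complex.Im w ^+ 2)) +i*
     atan (complex.Im w / complex.Re w).
pose E (s : R) : C := cexp (p%:C * L s).
have tz t : 0 <= t <= 1 -> cabs (t%:C * z) <= r.
  move=> /andP[t0 t1]; rewrite cabsM cabs_real ger0_norm//.
  by apply: le_trans zr; rewrite ler_piMl ?cabs_ge0.
have EE t : 0 <= t <= 1 -> E t = cpow (1 - t%:C * z) p.
  move=> t01; have h := le_lt_trans (tz _ t01) r1.
  rewrite cpowE carg_atan; last exact: Re1B_gt0.
  rewrite /E /L -cabs_sqr.
  rewrite lnXn ?cabs1B_gt0// -[ln _ *+ 2]mulr_natl mulrA mulVf ?pnatr_eq0//
    mul1r.
  by congr cexp; simpc.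
have dE t : 0 <= t <= 1 ->
    is_cderive E t (p%:C * (- z / (1 - t%:C * z)) * E t).
  move=> t01; have h := le_lt_trans (tz _ t01) r1.
  apply: is_cderive_cexp; apply: is_cderive_eq.
    apply: is_cderiveM; first exact: is_cderive_cst.
    by apply: is_cderive_log1B; rewrite gt_eqF// Re1B_gt0.
  by rewrite mul0r add0r.
pose G s := E s * binsum p N.+1 (s%:C * z).
pose dG t := - E t / (1 - t%:C * z) *
  (z * ((N%:R + p) * binc p N * t ^+ N)%:C * z ^+ N).
have dGE t : 0 <= t <= 1 -> is_cderive G t (dG t).
  move=> t01; have h := oneB_neq0 _ (le_lt_trans (tz _ t01) r1).
  apply: is_cderive_eq.
    by apply: is_cderiveM; [exact: dE|exact: is_cderive_binsum].
  have -> : dbinsum p N.+1 z t = (p%:C * z * binsum p N.+1 (t%:C * z) -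
    z * ((N%:R + p) * binc p N * t ^+ N)%:C * z ^+ N) / (1 - t%:C * z).
    by rewrite -binsum_ode mulrC mulKf.
  by rewrite /dG; field.
have -> : cpow (1 - z) p * binsum p N.+1 z - 1 = G 1 - G 0.
  rewrite /G EE ?ler01 ?lexx//= EE ?ler01 ?lexx//= mul1r mul0r subr0.
  have -> : cpow 1 p = 1 :> C by rewrite cpow_real ?powR1.
  suff -> : binsum p N.+1 0 = 1 by rewrite mul1r.
  rewrite /binsum big_ord_recl /= binc0 big1 ?addr0 ?mulr1//.
  by move=> i _; rewrite expr0n/= mulr0.
apply: cderive_bound dGE _ => t t01.
have h := le_lt_trans (tz _ t01) r1.
rewrite /dG EE// !cabsM cabsN cabsV cabs_cpow ?oneB_neq0// cabs_real cabsX.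
have b0 : 0 <= (N%:R + p) * binc p N.
  by rewrite mulr_ge0 ?addr_ge0 ?binc_ge0// ltW.
case/andP: (t01) => t0 t1.
rewrite ger0_norm; last by rewrite mulr_ge0// exprn_ge0.
apply: ler_pM.
- by rewrite divr_ge0// ?powR_ge0 ?cabs_ge0.
- by rewrite !mulr_ge0// ?exprn_ge0 ?cabs_ge0// ?addr_ge0 ?binc_ge0// ltW.
- apply: ler_pM; rewrite ?powR_ge0 ?invr_ge0 ?cabs_ge0//.
    apply: ge0_ler_powR; rewrite ?nnegrE ?cabs_ge0 ?(ltW p0)//.
    apply: le_trans (cabsD _ _) _; rewrite cabs1 cabsN.
    by rewrite -[2]/(1 + 1) lerD2l ltW.
  rewrite lef_pV2 ?posrE ?subr_gt0 ?cabs1B_gt0//.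
  by apply: le_trans (cabs1B_ge _); rewrite lerB// tz.
- rewrite (_ : _ * _ = (N%:R + p) * binc p N * (t ^+ N * cabs z ^+ N.+1));
    last by rewrite exprS; ring.
  apply: ler_wpM2l => //; apply: (@le_trans _ _ (cabs z ^+ N.+1)).
    by rewrite ler_piMl ?exprn_ge0 ?cabs_ge0// exprn_ile1.
  apply: (@le_trans _ _ (r ^+ N.+1)).
    by rewrite lerXn2r// nnegrE cabs_ge0.
  by rewrite exprS ler_piMl ?exprn_ge0// ltW.
Qed.

(** Ratio test: consecutive terms have ratio r + p r / (N + 1), eventually at most the midpoint [q]
    of r and 1, so a geometric sequence dominates. *)
Lemma binsum_err_cvg0 p r : 0 < p -> 0 <= r < 1 ->
  ((N%:R + p) * binc p N * r ^+ N) @[N --> \oo] --> 0.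
Proof.
move=> p0 /andP[r0 r1].
pose u N := (N%:R + p) * binc p N * r ^+ N.
pose q := (1 + r) / 2.
have q1 : `|q| < 1 by rewrite ger0_norm /q; lra.
have u0 N : 0 <= u N.
  by rewrite !mulr_ge0 ?exprn_ge0 ?binc_ge0 ?addr_ge0// ltW.
(* Past 2 (1 + p) / (1 - r), the excess p r / (N + 1) is at most (1 - r) / 2 = q - r. *)
pose n0 := (Num.trunc (2 * (1 + p) / (1 - r))).+1.
have uS N : (n0 <= N)%N -> u N.+1 <= q * u N.
  move=> nN; rewrite /u bincS exprS.
  have N0 : (0 : R) < N.+1%:R by rewrite ltr0n.
  have h : (N.+1%:R + p) * r <= q * N.+1%:R.
    have : 2 * (1 + p) / (1 - r) < N%:R.
      apply: lt_le_trans (_ : n0%:R <= _); last by rewrite ler_nat.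
      exact: Num.Theory.truncnS_gt.
    rewrite ltr_pdivrMr ?subr_gt0// => hN.
    rewrite -natr1 /q; nra.
  have -> : (N.+1%:R + p) * (binc p N * ((N%:R + p) / N.+1%:R)) * (r * r ^+ N)
     = ((N.+1%:R + p) * r / N.+1%:R) * ((N%:R + p) * binc p N * r ^+ N).
    by field; rewrite gt_eqF//; lra.
  by apply: ler_wpM2r; [exact: u0|rewrite ler_pdivrMr].
have ub k : u (k + n0)%N <= q ^+ k * u n0.
  elim: k => [|k IH]; first by rewrite expr0 mul1r.
  rewrite addSn exprS -mulrA; apply: le_trans (uS _ (leq_addl _ _)) _.
  by apply: ler_wpM2l => //; rewrite /q; lra.
rewrite -(cvg_shiftn n0); apply: (@squeeze_cvgr _ _ _ _ (fun=> 0)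
  (fun k => q ^+ k * u n0)).
- by near=> k; rewrite [leLHS]/= u0/= ub.
- exact: cvg_cst.
- rewrite -[X in _ --> X](mul0r (u n0)); apply: cvgMl; exact: cvg_expr.
Unshelve. all: end_near. Qed.

End BinomialSeries.

(** * Area measure on the disk *)

Section LebesgueAffine.
Context {R : realType}.
Local Open Scope classical_set_scope.
Local Notation mu := (@lebesgue_measure R).
Local Notation TR := (measurableTypeR R).
Implicit Types (A : set R) (a b r : R).

(** The pushforward agrees with Lebesgue measure on the intervals ]x, y], and these determine the
    measure. Scaling is handled in the same way. *)
Lemma lebesgue_measure_translation b A : measurable A ->
  mu ((fun x : R => x + b) @^-1` A) = mu A.
Proof.
move=> mA; apply/esym.
have mf : measurable_fun [set: TR] (fun x : TR => x + b : TR).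
  exact: measurable_funD.
pose m0 : {measure set TR -> \bar R} := pushforward mu
  (fun x : TR => x + b : TR).
pose m := m0 mf.
suff mE X : ocitv X -> mu X = m X by exact: (@lebesgue_measure_unique R m mE A).
move=> [[x y]] _ <-.
have e : (fun x : R => x + b) @^-1` `]x, y]%classic =
    `](x - b), (y - b)]%classic.
  by apply/seteqP; split => z /=; rewrite !in_itv/= ltrBlDr lerBrDr.
rewrite /m /m0 /= /pushforward [in RHS]e !lebesgue_measure_itv/= !lte_fin.
rewrite ltrD2r; case: ifPn => // _.
by rewrite -!EFinB; congr EFin; ring.
Qed.

Lemma lebesgue_measure_scaling r A : 0 < r -> measurable A ->
  mu ((fun x : R => r * x) @^-1` A) = (r^-1%:E * mu A)%E.
Proof.
move=> r0 mA.
have mf : measurable_fun [set: TR] (fun x : TR => r * x : TR).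
  exact: measurable_funM.
pose m0 : {measure set TR -> \bar R} :=
  mscale (NngNum (ltW r0)) (pushforward mu (fun x : TR => r * x : TR)).
pose m := m0 mf.
suff -> : mu A = m A.
  rewrite /m /m0 /= /mscale/= /pushforward muleA -EFinM mulVf ?gt_eqF// mul1e//.
suff mE X : ocitv X -> mu X = m X by exact: (@lebesgue_measure_unique R m mE A).
move=> [[x y]] _ <-.
have e : (fun x : R => r * x) @^-1` `]x, y]%classic =
    `](x / r), (y / r)]%classic.
  apply/seteqP; split => z /=; rewrite !in_itv/= ltr_pdivrMr// ler_pdivlMr//;
    by rewrite mulrC.
rewrite /m /m0 /= /mscale/= /pushforward [in RHS]e !lebesgue_measure_itv/=
  !lte_fin.
rewrite ltr_pM2r ?invr_gt0//; case: ifPn => _; last by rewrite mule0.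
by rewrite -!EFinD -EFinM; congr EFin; field; rewrite gt_eqF.
Qed.

End LebesgueAffine.

(** * Shears, rotations and dilations of the plane *)

Section PlaneLebesgue.
Context {R : realType}.
Local Open Scope classical_set_scope.
Local Notation mu := (@lebesgue_measure R).
Local Notation TR := (measurableTypeR R).
Local Notation mu2 := (mu \x mu)%E.
Implicit Types (A : set (TR * TR)) (a r c s : R).

(** The product measure is defined by slices at fixed x; its uniqueness gives the slices at fixed y,
    along which maps acting on the first coordinate are translations or scalings. *)
Lemma plane_lebesgue_ysection A : measurable A ->
  (mu2 A = \int[mu]_y mu (ysection A y))%E.
Proof.
move=> mA.
have h := @product_measure_unique _ _ _ _ R mu mu (mu \x^ mu)%E _ A mA.
by rewrite h // => B D mB mD; exact: product_measure2E.
Qed.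

Lemma measurable_shearx a :
  measurable_fun [set: TR * TR]
    (fun p : TR * TR => (p.1 + a * p.2, p.2) : TR * TR).
Proof.
apply: measurable_fun_pair => //=; apply: measurable_funD => //.
exact: measurable_funM.
Qed.

Lemma measurable_sheary a :
  measurable_fun [set: TR * TR]
    (fun p : TR * TR => (p.1, p.2 + a * p.1) : TR * TR).
Proof.
apply: measurable_fun_pair => //=; apply: measurable_funD => //.
exact: measurable_funM.
Qed.

Lemma measurable_preimageT d d' (T : measurableType d) (U : measurableType d')
  (f : T -> U) (A : set U) : measurable_fun [set: T] f -> measurable A ->
  measurable (f @^-1` A).
Proof. by move=> mf mA; rewrite -[X in measurable X]setTI; exact: mf. Qed.

Lemma plane_lebesgue_shearx a A : measurable A ->
  mu2 ((fun p : TR * TR => (p.1 + a * p.2, p.2) : TR * TR) @^-1` A) = mu2 A.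
Proof.
move=> mA; rewrite !plane_lebesgue_ysection//; last first.
  exact: measurable_preimageT (measurable_shearx a) mA.
apply: eq_integral => y _.
rewrite -(lebesgue_measure_translation (a * y) (ysection A y)); last first.
  exact: measurable_ysection.
by congr (mu _); apply/seteqP; split => x /=; rewrite /ysection/= !inE.
Qed.

Lemma plane_lebesgue_sheary a A : measurable A ->
  mu2 ((fun p : TR * TR => (p.1, p.2 + a * p.1) : TR * TR) @^-1` A) = mu2 A.
Proof.
move=> mA; apply: eq_integral => x _ /=.
rewrite -(lebesgue_measure_translation (a * x) (xsection A x)); last first.
  exact: measurable_xsection.
by congr (mu _); apply/seteqP; split => y /=; rewrite /xsection/= !inE.
Qed.

Definition plane_rotation c s (p : TR * TR) : TR * TR :=
  (c * p.1 - s * p.2, s * p.1 + c * p.2).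

Lemma measurable_plane_rotation c s :
  measurable_fun [set: TR * TR] (plane_rotation c s).
Proof.
apply: measurable_fun_pair => //=.
  by apply: measurable_funB => //; exact: measurable_funM.
by apply: measurable_funD => //; exact: measurable_funM.
Qed.

(* A rotation is a product of three shears, each of which preserves the
   measure by Fubini and translation invariance on the line. *)
Lemma plane_lebesgue_rotation c s A : s != 0 -> c ^+ 2 + s ^+ 2 = 1 ->
  measurable A -> mu2 (plane_rotation c s @^-1` A) = mu2 A.
Proof.
move=> s0 cs mA.
(* For c = cos theta and s = sin theta this is - tan (theta / 2), the slope of the two outer
   shears. *)
pose a := (c - 1) / s.
pose fx := (fun p : TR * TR => (p.1 + a * p.2, p.2) : TR * TR).
pose fy := (fun p : TR * TR => (p.1, p.2 + s * p.1) : TR * TR).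
have -> : plane_rotation c s @^-1` A = fx @^-1` (fy @^-1` (fx @^-1` A)).
  suff -> : plane_rotation c s = fx \o fy \o fx by [].
  have e : s * a = c - 1 by rewrite /a mulrC divfK.
  have e1 : 1 + s * a = c by rewrite e addrC subrK.
  have e2 : a * c + a = - s.
    apply: (mulfI s0); rewrite mulrDr mulrA e mulrN -expr2.
    have -> : s ^+ 2 = 1 - c ^+ 2 by rewrite -cs; ring.
    by ring.
  apply/funext => -[x y]; rewrite /plane_rotation /fx /fy /=; congr pair.
    have -> : x + a * y + a * (y + s * (x + a * y)) =
       (1 + s * a) * x + (a * (1 + s * a) + a) * y by ring.
    by rewrite e1 e2; ring.
  have -> : y + s * (x + a * y) = s * x + (1 + s * a) * y by ring.
  by rewrite e1 addrC.
have mx := measurable_shearx a; have my := measurable_sheary s.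
rewrite plane_lebesgue_shearx; last first.
  exact: measurable_preimageT my (measurable_preimageT _ _ _ _ _ _ mx mA).
rewrite plane_lebesgue_sheary; last exact: measurable_preimageT mx mA.
exact: plane_lebesgue_shearx.
Qed.

Lemma plane_lebesgue_scaling r A : 0 < r -> measurable A ->
  (mu2 ((fun p : TR * TR => (r * p.1, r * p.2)%R : TR * TR) @^-1` A) =
   (r ^- 2)%:E * mu2 A)%E.
Proof.
move=> r0 mA.
pose f1 := (fun p : TR * TR => (r * p.1, p.2) : TR * TR).
pose f2 := (fun p : TR * TR => (p.1, r * p.2) : TR * TR).
have m1 : measurable_fun [set: TR * TR] f1.
  by apply: measurable_fun_pair => //=; exact: measurable_funM.
have m2 : measurable_fun [set: TR * TR] f2.
  by apply: measurable_fun_pair => //=; exact: measurable_funM.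
have h1 B : measurable B -> (mu2 (f1 @^-1` B) = r^-1%:E * mu2 B)%E.
  move=> mB; rewrite !plane_lebesgue_ysection//; last first.
    exact: measurable_preimageT m1 mB.
  rewrite -ge0_integralZl//; last 2 first.
  - exact: measurable_fun_ysection.
  - by rewrite lee_fin invr_ge0 ltW.
  apply: eq_integral => y _.
  rewrite (_ : ysection (f1 @^-1` B) y =
      (fun x : R => r * x) @^-1` (ysection B y)); last first.
    by apply/seteqP; split => x /=; rewrite /ysection/= !inE.
  by apply: lebesgue_measure_scaling => //; exact: measurable_ysection.
have h2 B : measurable B -> (mu2 (f2 @^-1` B) = r^-1%:E * mu2 B)%E.
  move=> mB; rewrite /product_measure1.
  rewrite -ge0_integralZl//; last 2 first.
  - exact: measurable_fun_xsection.
  - by rewrite lee_fin invr_ge0 ltW.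
  apply: eq_integral => x _ /=.
  rewrite (_ : xsection (f2 @^-1` B) x =
      (fun y : R => r * y) @^-1` (xsection B x)); last first.
    by apply/seteqP; split => y /=; rewrite /xsection/= !inE.
  by apply: lebesgue_measure_scaling => //; exact: measurable_xsection.
rewrite (_ : _ @^-1` A = f1 @^-1` (f2 @^-1` A))//.
rewrite h1; last exact: measurable_preimageT m2 mA.
by rewrite h2// muleA -EFinM -expr2 exprVn.
Qed.

End PlaneLebesgue.

(** * Normalized area and the law of |w|^2 *)

Section DiskMeasure.
Context {R : realType}.
Local Open Scope classical_set_scope.
Local Notation mu := (@lebesgue_measure R).
Local Notation TR := (measurableTypeR R).
Local Notation mu2 := (mu \x mu)%E.
Implicit Types (A : set (TR * TR)) (t r c s : R).

Definition sqmod (p : TR * TR) : TR := p.1 ^+ 2 + p.2 ^+ 2.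

Lemma sqmod_ge0 p : 0 <= sqmod p.
Proof. by rewrite addr_ge0 ?sqr_ge0. Qed.

Lemma cabs_sqmod p : cabs (to_complex p) ^+ 2 = sqmod p.
Proof. by rewrite cabs_sqr. Qed.

Lemma measurable_sqmod : measurable_fun [set: TR * TR] sqmod.
Proof.
by apply: measurable_funD; apply: measurable_funX.
Qed.

Lemma plane_diskE (p : TR * TR) : plane_disk p <-> sqmod p < 1.
Proof.
have -> : (sqmod p < 1) = (cabs (to_complex p) < 1); last by [].
by rewrite -(@ltr_pXn2r _ 2 _ (cabs _)) ?nnegrE ?cabs_ge0// cabs_sqmod expr1n.
Qed.

Lemma plane_disk_preimage :
  @plane_disk R = sqmod @^-1` `]-oo, 1%R[%classic.
Proof.
by apply/seteqP; split => p; rewrite plane_diskE /= in_itv/=.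
Qed.

Lemma measurable_sqmod_lt t :
  measurable (sqmod @^-1` `]-oo, t[%classic).
Proof. exact: measurable_preimageT measurable_sqmod _. Qed.

Lemma measurable_plane_disk : measurable (@plane_disk R : set (TR * TR)).
Proof. rewrite plane_disk_preimage; exact: measurable_sqmod_lt. Qed.

(** The disk lies in the square [-1, 1]^2. With [plane_disk_gt0], this makes the factor in [dA] a
    true inverse of the area, not a default value of [fine] or of the inverse of 0. *)
Lemma plane_disk_fin_num : (mu2 (@plane_disk R) \is a fin_num)%E.
Proof.
have h : (mu2 (`[(-1)%R, 1%R]%classic `*` `[(-1)%R, 1%R]%classic) < +oo)%E.
  rewrite product_measure1E//= !lebesgue_measure_itv/= lte_fin.
  by rewrite ifT ?ltry// -EFinD -EFinM ltry.
rewrite ge0_fin_numE; last exact: measure_ge0.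
apply: le_lt_trans h; apply: le_measure; rewrite ?inE.
- exact: measurable_plane_disk.
- exact: measurableX.
- move=> [x y]; rewrite plane_diskE /sqmod/= !in_itv/= => h.
  have x1 : x ^+ 2 <= 1 by apply: le_trans (ltW h); rewrite lerDl sqr_ge0.
  have y1 : y ^+ 2 <= 1 by apply: le_trans (ltW h); rewrite lerDr sqr_ge0.
  by rewrite -!ler_norml -(@ler_pXn2r _ 2) ?nnegrE// expr1n real_normK
    ?num_real//
    -(@ler_pXn2r _ 2 _ `|y|) ?nnegrE// expr1n real_normK ?num_real.
Qed.

Lemma plane_disk_gt0 : 0 < fine (mu2 (@plane_disk R)).
Proof.
apply: fine_gt0; rewrite -ge0_fin_numE ?measure_ge0// plane_disk_fin_num andbT.
have h : (0 < mu2 (`[0%R, 2^-1%R]%classic `*` `[0%R, 2^-1%R]%classic))%E.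
  rewrite product_measure1E//= !lebesgue_measure_itv/= lte_fin invr_gt0 ltr0n.
  by rewrite oppr0 adde0 -EFinM lte_fin mulr_gt0.
apply: lt_le_trans h _; apply: le_measure; rewrite ?inE.
- exact: measurableX.
- exact: measurable_plane_disk.
- move=> [x y]; rewrite plane_diskE /sqmod/= !in_itv/=.
  move=> -[/andP[x0 x1] /andP[y0 y1]].
  by nra.
Qed.

Lemma dA_E A : dA A = ((fine (mu2 (@plane_disk R)))^-1%:E * mu2 A)%E.
Proof. by []. Qed.

Lemma dA_plane_disk : dA (@plane_disk R) = 1%E.
Proof.
rewrite dA_E -[X in (_ * X)%E](fineK plane_disk_fin_num) -EFinM mulVf//.
by rewrite gt_eqF// plane_disk_gt0.
Qed.

Lemma dA_rotation c s A : s != 0 -> c ^+ 2 + s ^+ 2 = 1 -> measurable A ->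
  dA (plane_rotation c s @^-1` A) = dA A.
Proof. by move=> s0 cs mA; rewrite !dA_E plane_lebesgue_rotation. Qed.

(** The set is the unit disk dilated by sqrt t, hence of area t times that of the disk; the
    normalization spares the value pi. *)
Lemma dA_sqmod_lt t : 0 < t -> dA (sqmod @^-1` `]-oo, t[%classic) = t%:E.
Proof.
move=> t0; pose r := Num.sqrt t.
have r0 : 0 < r by rewrite sqrtr_gt0.
have rt : r ^+ 2 = t by rewrite sqr_sqrtr// ltW.
have e (u : R) : (t * u < t) = (u < 1) by rewrite -{2}[t]mulr1 ltr_pM2l.
have := plane_lebesgue_scaling r (sqmod @^-1` `]-oo, t[%classic) r0
  (measurable_sqmod_lt t).
rewrite (_ : _ @^-1` (_ @^-1` _) = @plane_disk R); last first.
  apply/seteqP; split => p; rewrite plane_diskE /= in_itv/= /sqmod/=;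
    by rewrite !exprMn -mulrDr rt e.
move=> h; rewrite -[RHS]mule1 -dA_plane_disk !dA_E h rt.
rewrite muleCA (muleA (t%:E)) -EFinM divff ?mul1e//.
by rewrite gt_eqF.
Qed.

(** Open left half-lines generate the Borel sets and are stable under intersection, so it is enough
    to compare the measures on them. Restriction to [0, 1[ makes both measures finite. *)
Lemma dA_sqmod (B : set TR) : measurable B -> B `<=` `[0, 1[ ->
  dA (sqmod @^-1` B) = mu B.
Proof.
move=> mB B01.
have mI : measurable (`[0%R, 1%R[%classic : set TR) by [].
pose nu0 : {measure set TR -> \bar R} := pushforward (@dA R) sqmod.
pose nu1 := nu0 measurable_sqmod.
pose m1 : {measure set TR -> \bar R} := mrestr nu1 mI.
pose m2 : {measure set TR -> \bar R} := mrestr mu mI.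
suff h : m1 B = m2 B.
  by move: h; rewrite /m1 /m2 /= /mrestr (setIidl B01).
pose g (n : nat) := `]-oo, n%:R[%classic : set TR.
refine (@measure_unique _ R TR (@RGenInftyO.G R) g _ _ _ _ m1 m2 _ _ B mB).
- exact: RGenInftyO.measurableE.
- move=> X Y [x ->] [y ->]; exists (Num.min x y).
  by apply/seteqP; split => z /=; rewrite !in_itv/= lt_min; move/andP.
- by move=> n; exists n%:R.
- apply/seteqP; split => // x _; exists (Num.trunc x).+1 => //.
  by rewrite /g/= in_itv/= truncnS_gt.
- move=> X [x ->].
  rewrite /m1 /m2 /= /mrestr /nu1 /nu0/= /pushforward.
  have [x0|x0] := leP x 0.
    rewrite (_ : _ `&` _ = set0) ?preimage_set0 ?measure0//.
    apply/seteqP; split => // z /=; rewrite !in_itv/= => -[zx /andP[z0 _]].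
    by move: zx; rewrite ltNge (le_trans x0 z0).
  rewrite (_ : _ `&` _ = `[0%R, (Num.min x 1)[%classic); last first.
    apply/seteqP; split => z /=; rewrite !in_itv/= lt_min.
      by move=> [-> /andP[-> ->]].
    by move=> /and3P[-> -> ->].
  have m0 : 0 < Num.min x 1 by rewrite lt_min x0 ltr01.
  rewrite lebesgue_measure_itv/= lte_fin m0 oppr0 adde0.
  rewrite -(dA_sqmod_lt _ m0); congr (dA _).
  by apply/seteqP; split => p /=; rewrite !in_itv/= sqmod_ge0.
- move=> k; rewrite /m1 /= /mrestr /nu1 /nu0/= /pushforward.
  apply: (@le_lt_trans _ _ (dA (@plane_disk R))); last first.
    by rewrite dA_plane_disk ltry.
  apply: le_measure; rewrite ?inE.
  - apply: (measurable_preimageT _ _ _ _ _ _ measurable_sqmod).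
    by apply: measurableI => //; exact: measurable_itv.
  - exact: measurable_plane_disk.
  - move=> p /= [_]; rewrite in_itv/= => /andP[_ h].
    by rewrite plane_diskE.
Qed.

End DiskMeasure.

(** * The integral of the radial weight *)

Section DiskMoments.
Context {R : realType}.
Local Open Scope classical_set_scope.
Import numFieldNormedType.Exports.
Local Notation mu := (@lebesgue_measure R).
Local Notation TR := (measurableTypeR R).
Implicit Types (g t : R) (n : nat).

Lemma is_derive_onem_powR g t : t < 1 ->
  is_derive t 1 (fun s : R => (1 - s) `^ g) (- (g * (1 - t) `^ (g - 1))).
Proof.
move=> t1; have h : 0 < 1 - t by rewrite subr_gt0.
have D1 : is_derive t 1 (fun s : R => 1 - s) (-1).
  rewrite (_ : (fun s => _) = cst 1 - (@id R)) //.
  by apply: is_derive_eq; rewrite sub0r.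
have D2 := @is_derive1_comp _ (fun x : R => x `^ g) (fun s : R => 1 - s)
  t _ _ (@is_derive1_powR R g (1 - t) h) D1.
by apply: is_derive_eq D2 _; rewrite mulrN1.
Qed.

Lemma integral_powR_onem_cc g (e : R) : -1 < g -> 0 < e < 1 ->
  (\int[mu]_(t in `[0%R, (1 - e)%R]) ((1 - t) `^ g)%:E =
   ((1 - e `^ (g + 1)) / (g + 1))%:E)%E.
Proof.
move=> g1 /andP[e0 e1].
have g0 : g + 1 != 0 by rewrite gt_eqF//; lra.
pose F : R -> R := (- (g + 1)^-1) *: (fun t => (1 - t) `^ (g + 1)).
have FE t : F t = - (g + 1)^-1 * (1 - t) `^ (g + 1) by [].
have dF (t : R) : t < 1 -> is_derive t 1 F ((1 - t) `^ g).
  move=> t1; have D := is_derive_onem_powR (g + 1) t t1.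
  by apply: is_derive_eq; rewrite /GRing.scale/= addrK; field.
have cF (t : R) : t < 1 -> {for t, continuous F}.
  move=> /dF h; apply: differentiable_continuous; apply/derivable1_diffP.
  exact: ex_derive.
rewrite (@continuous_FTC2 _ (fun t => (1 - t) `^ g) F)//.
- rewrite -EFinB !FE; congr EFin.
  have -> : 1 - (1 - e) = e by ring.
  by rewrite subr0 powR1; field.
- by rewrite subr_gt0.
- apply: derivable_within_continuous => t; rewrite in_itv/= => /andP[t0 te].
  have h : t < 1 by lra.
  exact: (@ex_derive _ _ _ _ _ _ _ (is_derive_onem_powR g t h)).
- split.
  + move=> t; rewrite in_itv/= => /andP[t0 te].
    have h : t < 1 by lra.
    by have ? := dF t h; exact: ex_derive.
  + by apply: cvg_at_right_filter; apply: cF.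
  + by apply: cvg_at_left_filter; apply: cF; lra.
- move=> t; rewrite in_itv/= => /andP[t0 te].
  have h : t < 1 by lra.
  by have ? := dF t h; rewrite derive1E derive_val.
Qed.

Lemma measurable_onem_powR g :
  measurable_fun [set: TR] (fun t : TR => (1 - t) `^ g : TR).
Proof.
have h : measurable_fun [set: TR] (fun t : TR => 1 - t : TR).
  exact: measurable_funB.
exact: (measurableT_comp (measurable_powR g) h).
Qed.

(** For g < 0 the integrand is singular at 1, so the fundamental theorem is used on [0, 1 - e] and e
    is sent to 0 by monotone convergence; the term e^(g+1) vanishes because g > -1. *)
Lemma integral_powR_onem g : -1 < g ->
  (\int[mu]_(t in `[0%R, 1%R[) ((1 - t) `^ g)%:E = ((g + 1)^-1)%:E)%E.
Proof.
move=> g1.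
have mf := measurable_onem_powR g.
(* The offset 2 keeps the gap e strictly below 1 already at n = 0. *)
pose S n := `[0%R, (1 - n.+2%:R^-1)%R]%classic : set R.
have e01 n : 0 < (n.+2%:R^-1 : R) < 1.
  by rewrite invr_gt0 ltr0n invf_lt1 ?ltr0n// ltr1n.
have US : `[0%R, 1%R[%classic = \bigcup_n S n.
  apply/seteqP; split => t /=.
    rewrite in_itv/= => /andP[t0 t1].
    exists (Num.trunc ((1 - t)^-1)) => //=; rewrite /S/= in_itv/= t0/=.
    rewrite lerBrDr addrC -lerBrDr -[leRHS]invrK lef_pV2 ?posrE ?invr_gt0
      ?subr_gt0//.
    by apply: le_trans (ltW (truncnS_gt _)) _; rewrite ler_nat.
  move=> [n _]; rewrite /S/= !in_itv/= => /andP[-> h].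
  apply: le_lt_trans h _; have /andP[h _] := e01 n.
  by rewrite ltrBlDr ltrDl; exact: h.
have ndS : nondecreasing_seq S.
  move=> m n mn; rewrite subsetEset => t;
    rewrite /S/= !in_itv/= => /andP[-> h]/=.
  apply: le_trans h _; rewrite lerD2l lerN2.
  by rewrite (@lef_pV2 R) ?posrE ?ltr0n// ler_nat.
rewrite US -(cvg_lim _ (@ge0_nondecreasing_set_cvg_integral _ TR R S
  (fun t => ((1 - t) `^ g)%:E) _ ndS _ _ _))//; last 3 first.
- by move=> n; exact: measurable_itv.
- by move=> n; apply/measurable_EFinP; exact: measurable_funTS mf.
- by move=> n t _; rewrite lee_fin powR_ge0.
apply: cvg_lim => //.
rewrite [X in X @ _ --> _](_ : _ = fun n : nat =>
    (((1 - n.+2%:R^-1 `^ (g + 1)) / (g + 1))%:E)); last first.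
  by apply/funext => n; rewrite /S integral_powR_onem_cc.
apply: cvg_EFin; first by near=> n.
rewrite -[X in _ --> X]mul1r; apply: cvgMl.
rewrite -[X in _ --> X]subr0; apply: cvgB; first exact: cvg_cst.
have h : 0 < g + 1 by lra.
have := @powR_cvg0 R (g + 1) h.
move/cvgrPdist_lt => K; apply/cvgrPdist_lt => eps eps0.
have [d /= d0 Hd] := K eps eps0.
have [N _ HN] := @near_infty_natSinv_lt R (PosNum d0).
exists N => // n /= Nn; apply: Hd; last by rewrite invr_gt0 (ltr0n R).
rewrite /= sub0r normrN ger0_norm ?invr_ge0 ?(ler0n R)//.
apply: le_lt_trans (HN n Nn).
by rewrite (@lef_pV2 R) ?posrE ?ltr0n// ler_nat.
Unshelve. all: end_near. Qed.

Lemma integral_disk_powR g : -1 < g ->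
  (\int[@dA R]_(p in @plane_disk R) ((1 - sqmod p) `^ g)%:E =
   ((g + 1)^-1)%:E)%E.
Proof.
move=> g1; rewrite -integral_powR_onem//.
have mf := measurable_onem_powR g.
rewrite (_ : @plane_disk R = sqmod @^-1` `[0%R, 1%R[%classic); last first.
  by apply/seteqP; split => p; rewrite plane_diskE /= in_itv/= sqmod_ge0.
rewrite -(@ge0_integral_pushforward _ _ _ _ R _ measurable_sqmod (@dA R)
  `[0%R, 1%R[%classic
  (fun t : TR => ((1 - t) `^ g)%:E))//.
- apply: eq_measure_integral => [|B mB B01]; first exact: measurable_sqmod.
  exact: dA_sqmod.
- by apply/measurable_EFinP; exact: measurable_funTS mf.
- by move=> t _; rewrite lee_fin powR_ge0.
Qed.

End DiskMoments.

(** * Radial moments and bounded measurable functions *)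

Section DiskIntegral.
Context {R : realType}.
Local Open Scope classical_set_scope.
Local Open Scope complex_scope.
Local Notation C := R[i].
Local Notation TR := (measurableTypeR R).
Local Notation D := (@plane_disk R : set (TR * TR)).
Implicit Types (g t c s M : R) (n m : nat) (u v : TR * TR -> R) (h k : C -> C).

Lemma integrable_onem_sqmod g : -1 < g ->
  (@dA R).-integrable D (EFin \o (fun p => (1 - sqmod p) `^ g)).
Proof.
move=> g1; apply/integrableP; split.
  apply/measurable_EFinP; apply: measurable_funTS.
  exact: (measurableT_comp (measurable_onem_powR g) measurable_sqmod).
rewrite (_ : (\int[_]_(_ in _) _)%E = ((g + 1)^-1)%:E) ?ltry//.
rewrite -integral_disk_powR//; apply: eq_integral => p _ /=.
by rewrite ger0_norm// powR_ge0.
Qed.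

Lemma integrable_bounded_onem_sqmod u g M : -1 < g -> measurable_fun D u ->
  (forall p, D p -> `|u p| <= M) ->
  (@dA R).-integrable D (fun p => (u p * (1 - sqmod p) `^ g)%:E).
Proof.
move=> g1 mu uM.
have := @integrableMr _ _ _ (@dA R) D measurable_plane_disk u _ mu _
  (integrable_onem_sqmod g g1).
apply; exists M; split; first exact: num_real.
by move=> x Mx p Dp; apply: le_trans (ltW Mx); exact: uM.
Qed.

Lemma measurable_fun_sqmodX n : measurable_fun D (fun p => sqmod p ^+ n).
Proof.
apply: measurable_funTS; apply: measurable_funX; exact: measurable_sqmod.
Qed.

Lemma sqmodX_le1 n p : D p -> `|sqmod p ^+ n| <= 1.
Proof.
rewrite plane_diskE => p1; rewrite ger0_norm ?exprn_ge0 ?sqmod_ge0//.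
by rewrite exprn_ile1 ?sqmod_ge0// ltW.
Qed.

Lemma bincD1 (p : R) n : 0 < p -> binc (p + 1) n = binc p n * ((p + n%:R) / p).
Proof.
move=> p0; elim: n => [|n IH]; first by rewrite !binc0 addr0 divff ?gt_eqF//
  mulr1.
have n0 : (n.+1%:R : R) != 0 by rewrite pnatr_eq0.
rewrite !bincS IH -!natr1; field; rewrite natr1 n0/= gt_eqF//=.
Qed.

Lemma binc_gt0 (p : R) n : 0 < p -> 0 < binc p n.
Proof.
by move=> p0; apply: prodr_gt0 => k _; rewrite divr_gt0 ?ltr0n// ltr_wpDl.
Qed.

(** With t = |w|^2 this is the Beta integral B(n + 1, g + 1). The induction needs all g at once:
    t^(n+1) (1 - t)^g is the difference of t^n (1 - t)^g and t^n (1 - t)^(g+1). *)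
Lemma disk_moment n g : -1 < g ->
  \int[@dA R]_(p in D) (sqmod p ^+ n * (1 - sqmod p) `^ g) =
  ((g + 1) * binc (g + 2) n)^-1.
Proof.
elim: n g => [|n IH] g g1.
  rewrite binc0 mulr1 /Rintegral.
  under eq_integral do rewrite expr0 mul1r.
  by rewrite integral_disk_powR.
have g11 : -1 < g + 1 by lra.
rewrite (@eq_Rintegral _ _ _ _ _ (fun p => sqmod p ^+ n * (1 - sqmod p) `^ g -
   sqmod p ^+ n * (1 - sqmod p) `^ (g + 1))); last first.
  move=> p; rewrite inE plane_diskE => p1.
  have p0 : 0 < 1 - sqmod p by rewrite subr_gt0.
  rewrite powRD; last by rewrite (gt_eqF p0) implybT.
  by rewrite powRr1 ?(ltW p0)// exprS; ring.
have i1 e : -1 < e -> (@dA R).-integrable D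
    (EFin \o (fun p => sqmod p ^+ n * (1 - sqmod p) `^ e)).
  move=> e1; apply: (@integrable_bounded_onem_sqmod _ e 1) => //.
    exact: measurable_fun_sqmodX.
  by move=> p; exact: sqmodX_le1.
rewrite RintegralB//; [|exact: measurable_plane_disk|exact: i1|exact: i1].
rewrite !IH// (_ : g + 1 + 2 = g + 2 + 1); last by ring.
rewrite bincD1; last by lra.
rewrite bincS.
have h3 : binc (g + 2) n != 0 by rewrite gt_eqF// binc_gt0//; lra.
have n0 : (0 : R) <= n%:R by rewrite ler0n.
rewrite -natr1; field.
by do ?[apply/andP; split]; first [exact: h3 | rewrite gt_eqF//; lra].
Qed.

(** A class closed under sums, products, conjugation and uniform limits, whose members are all
    integrable against the weight. *)
Definition bounded_measurable h : Prop :=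
  [/\ measurable_fun D (fun p => complex.Re (h (to_complex p)) : TR),
      measurable_fun D (fun p => complex.Im (h (to_complex p)) : TR) &
      exists M, forall w, unit_disk w -> cabs (h w) <= M].

Lemma bounded_measurable_cst (a : C) : bounded_measurable (fun=> a).
Proof. by split; [exact: measurable_cst..|exists (cabs a)]. Qed.

Lemma bounded_measurable_id : bounded_measurable id.
Proof.
split; [exact: measurable_funTS measurable_fst|
  exact: measurable_funTS measurable_snd|by exists 1 => w /ltW].
Qed.

Lemma bounded_measurable_conj h :
  bounded_measurable h -> bounded_measurable (fun w => (h w)^*%C).
Proof.
move=> [h1 h2 [M hM]]; split.
- by rewrite (_ : (fun p => _) = (fun p => complex.Re (h (to_complex p)) : TR));
    last by apply/funext => p; case: (h _).
- rewrite (_ : (fun p => _) = (\- (fun p =>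
    complex.Im (h (to_complex p)) : TR)));
    last by apply/funext => p /=; case: (h _).
  exact: measurable_funN.
- by exists M => w /hM; rewrite cabs_conj.
Qed.

Lemma bounded_measurableD h k : bounded_measurable h -> bounded_measurable k ->
  bounded_measurable (fun w => h w + k w).
Proof.
move=> [h1 h2 [M hM]] [k1 k2 [N kN]]; split.
- under eq_fun do rewrite RecD; exact: measurable_funD.
- under eq_fun do rewrite ImcD; exact: measurable_funD.
- exists (M + N) => w Dw; apply: le_trans (cabsD _ _) _.
  by apply: lerD; [exact: hM|exact: kN].
Qed.

Lemma bounded_measurableM h k : bounded_measurable h -> bounded_measurable k ->
  bounded_measurable (fun w => h w * k w).
Proof.
move=> [h1 h2 [M hM]] [k1 k2 [N kN]]; split.
- under eq_fun do rewrite RecM.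
  by apply: measurable_funB; apply: measurable_funM.
- under eq_fun do rewrite ImcM.
  by apply: measurable_funD; apply: measurable_funM.
- exists (M * N) => w Dw; rewrite cabsM.
  by apply: ler_pM; rewrite ?cabs_ge0//; [exact: hM|exact: kN].
Qed.

Lemma bounded_measurableX h n : bounded_measurable h ->
  bounded_measurable (fun w => h w ^+ n).
Proof.
move=> bh; elim: n => [|n IH].
  by under eq_fun do rewrite expr0; exact: bounded_measurable_cst.
by under eq_fun do rewrite exprS; exact: bounded_measurableM.
Qed.

Lemma bounded_measurable_sum (F : nat -> C -> C) n :
  (forall i, bounded_measurable (F i)) ->
  bounded_measurable (fun w => \sum_(i < n) F i w).
Proof.
move=> bF; elim: n => [|n IH].
  by under eq_fun do rewrite big_ord0; exact: bounded_measurable_cst.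
by under eq_fun do rewrite big_ord_recr/=; exact: bounded_measurableD.
Qed.

(** Through this lemma the kernels inherit measurability from polynomials. *)
Lemma bounded_measurable_limit (F : nat -> C -> C) h (e : nat -> R) :
  (forall n, bounded_measurable (F n)) ->
  (forall n w, unit_disk w -> cabs (F n w - h w) <= e n) ->
  e n @[n --> \oo] --> 0 -> bounded_measurable h.
Proof.
move=> bF Fh e0.
have lim (f : nat -> TR * TR -> TR) (f0 : TR * TR -> TR) :
    (forall n, measurable_fun D (f n)) ->
    (forall n p, D p -> `|f n p - f0 p| <= e n) -> measurable_fun D f0.
  move=> mf ff; apply: (@measurable_fun_cvg _ _ R D f f0) => // p Dp.
  apply/cvgrPdist_le => eps eps0.
  move/cvgrPdist_le : e0 => /(_ _ eps0); apply: filterS => n.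
  rewrite sub0r normrN => en; rewrite distrC.
  by apply: le_trans (ff n p Dp) _; apply: le_trans en; exact: ler_norm.
split.
- apply: (lim (fun n p => complex.Re (F n (to_complex p)))).
    by move=> n; case: (bF n).
  move=> n p Dp; rewrite -RecN -RecD; apply: le_trans (Re_le_cabs _) _.
  exact: Fh.
- apply: (lim (fun n p => complex.Im (F n (to_complex p)))).
    by move=> n; case: (bF n).
  move=> n p Dp; rewrite -ImcN -ImcD; apply: le_trans (Im_le_cabs _) _.
  exact: Fh.
- have [_ _ [M hM]] := bF 0%N; exists (e 0%N + M) => w Dw.
  rewrite -[h w](subrK (F 0%N w)); apply: le_trans (cabsD _ _) _.
  by apply: lerD; [rewrite cabs_distC; exact: Fh|exact: hM].
Qed.

End DiskIntegral.

(** * Linearity, rotation invariance and orthogonality of monomials *)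

Section DiskIntegralTheory.
Context {R : realType} (g : R).
Hypothesis g1 : -1 < g.
Local Open Scope classical_set_scope.
Local Open Scope complex_scope.
Local Notation C := R[i].
Local Notation TR := (measurableTypeR R).
Local Notation D := (@plane_disk R : set (TR * TR)).
Local Notation W p := (weight g (to_complex p)).
Local Notation I u := (\int[@dA R]_(p in D) (u p * W p)).
Local Notation CI := (disk_integral g).
Implicit Types (c s M : R) (n m : nat) (u v : TR * TR -> TR) (h k : C -> C).

Let g_gt0 : 0 < g + 1. Proof. by rewrite -ltrBlDr sub0r. Qed.
Let g_ge0 : 0 <= g + 1. Proof. exact: ltW. Qed.
Let g_neq0 : g + 1 != 0. Proof. by rewrite gt_eqF. Qed.

Lemma weightE (p : TR * TR) : W p = (g + 1) * (1 - sqmod p) `^ g.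
Proof. by rewrite /weight cabs_sqmod. Qed.

Lemma weight_ge0 (p : TR * TR) : 0 <= W p.
Proof. by rewrite weightE mulr_ge0 ?powR_ge0. Qed.

Lemma integrable_weight u M : measurable_fun D u ->
  (forall p, D p -> `|u p| <= M) ->
  (@dA R).-integrable D (EFin \o (fun p => u p * W p)).
Proof.
move=> mu uM.
have := @integrable_bounded_onem_sqmod _ (fun p => (g + 1) * u p) g
  ((g + 1) * M) g1.
rewrite (_ : (fun p => _) = EFin \o (fun p => u p * W p)); last first.
  by apply/funext => p /=; rewrite weightE; congr EFin; ring.
apply; first exact: measurable_funM.
move=> p Dp; rewrite normrM (ger0_norm g_ge0).
by apply: ler_wpM2l; [exact: g_ge0|exact: uM].
Qed.

Lemma integrable_Re h : bounded_measurable h ->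
  (@dA R).-integrable D
    (EFin \o (fun p => complex.Re (h (to_complex p)) * W p)).
Proof.
move=> [h1 _ [M hM]]; apply: (integrable_weight _ M h1) => p Dp.
by apply: le_trans (Re_le_cabs _) _; exact: hM.
Qed.

Lemma integrable_Im h : bounded_measurable h ->
  (@dA R).-integrable D
    (EFin \o (fun p => complex.Im (h (to_complex p)) * W p)).
Proof.
move=> [_ h1 [M hM]]; apply: (integrable_weight _ M h1) => p Dp.
by apply: le_trans (Im_le_cabs _) _; exact: hM.
Qed.

Lemma disk_integral_ext h k : (forall w, unit_disk w -> h w = k w) ->
  CI h = CI k.
Proof.
move=> hk; congr (_ +i* _); apply: eq_Rintegral => p; rewrite inE => Dp;
  by rewrite hk.
Qed.

Lemma disk_integralD h k : bounded_measurable h -> bounded_measurable k ->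
  CI (fun w => h w + k w) = CI h + CI k.
Proof.
move=> bh bk; have mD := @measurable_plane_disk R.
apply/eqP; rewrite eq_complex RecD ImcD /=; apply/andP; split; apply/eqP.
- rewrite -RintegralD //; [|exact: integrable_Re..].
  by apply: eq_Rintegral => p _; rewrite RecD mulrDl.
- rewrite -RintegralD //; [|exact: integrable_Im..].
  by apply: eq_Rintegral => p _; rewrite ImcD mulrDl.
Qed.

Lemma disk_integralZ (a : C) h : bounded_measurable h ->
  CI (fun w => a * h w) = a * CI h.
Proof.
move=> bh; have mD := @measurable_plane_disk R.
have [iR iI] := (integrable_Re h bh, integrable_Im h bh).
have iZ (x : R) f : (@dA R).-integrable D (EFin \o f) ->
    (@dA R).-integrable D (EFin \o (fun p => x * f p)).
  move=> fi; have := @integrableZl _ _ _ (@dA R) D mD x _ fi.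
  by apply: eq_integrable => // p _; rewrite /= EFinM.
apply/eqP; rewrite eq_complex RecM ImcM /=; apply/andP; split; apply/eqP.
- rewrite -!RintegralZl// -RintegralB//; [|exact: iZ..].
  by apply: eq_Rintegral => p _; rewrite RecM; ring.
- rewrite -!RintegralZl// -RintegralD//; [|exact: iZ..].
  by apply: eq_Rintegral => p _; rewrite ImcM; ring.
Qed.

Lemma disk_integral_sum (F : nat -> C -> C) n :
  (forall i, bounded_measurable (F i)) ->
  CI (fun w => \sum_(i < n) F i w) = \sum_(i < n) CI (F i).
Proof.
move=> bF; elim: n => [|n IH].
  rewrite big_ord0 -[RHS](mul0r (CI (fun=> 0))) -disk_integralZ.
    by apply: disk_integral_ext => w _; rewrite big_ord0 mul0r.
  exact: bounded_measurable_cst.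
rewrite big_ord_recr/= -IH -disk_integralD//;
  last exact: bounded_measurable_sum.
by apply: disk_integral_ext => w _; rewrite big_ord_recr.
Qed.

Lemma integral_weight : \int[@dA R]_(p in D) W p = 1.
Proof.
rewrite (@eq_Rintegral _ _ _ _ _ (fun p =>
  (g + 1) * (sqmod p ^+ 0 * (1 - sqmod p) `^ g))); last first.
  by move=> p _; rewrite weightE expr0 mul1r.
rewrite RintegralZl.
- by rewrite disk_moment// binc0 mulr1 divff.
- exact: measurable_plane_disk.
- apply: (@integrable_bounded_onem_sqmod _ (fun p => sqmod p ^+ 0) g 1) =>
  [//||p];
    [exact: measurable_fun_sqmodX|exact: sqmodX_le1].
Qed.

Lemma disk_integral_le h M : bounded_measurable h ->
  (forall w, unit_disk w -> cabs (h w) <= M) -> cabs (CI h) <= 2 * M.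
Proof.
move=> bh hM; have mD := @measurable_plane_disk R.
have key u : measurable_fun D u -> (forall p, D p -> `|u p| <= M) ->
    `|I u| <= M.
  move=> mu uM; have iu := integrable_weight u M mu uM.
  apply: le_trans (le_normr_Rintegral _ iu) _ => //.
  have i1 : (@dA R).-integrable D (EFin \o (fun p => 1 * W p)).
    by apply: (@integrable_weight (fun=> 1) 1) => // p _; rewrite normr1.
  have {}i1 : (@dA R).-integrable D (EFin \o (fun p => W p)).
    by apply: eq_integrable i1 => // p _; rewrite /= mul1r.
  rewrite -[leRHS]mulr1 -integral_weight -RintegralZl//.
  apply: le_Rintegral => //.
  - exact: integrable_norm.
  - have := @integrableZl _ _ _ (@dA R) D mD M _ i1.
    by apply: eq_integrable => // p _; rewrite /= EFinM.
  - move=> p Dp; rewrite normrM (ger0_norm (weight_ge0 p)).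
    by apply: ler_wpM2r; [exact: weight_ge0|exact: uM].
case: bh => h1 h2 _.
apply: le_trans (cabs_le _) _; rewrite mulr_natl mulr2n; apply: lerD.
- by apply: (key _ h1) => p Dp; apply: le_trans (Re_le_cabs _) _; exact: hM.
- by apply: (key _ h2) => p Dp; apply: le_trans (Im_le_cabs _) _; exact: hM.
Qed.

Lemma sqmod_rotation c s p : c ^+ 2 + s ^+ 2 = 1 ->
  sqmod (plane_rotation c s p) = sqmod p.
Proof.
move=> cs; rewrite /sqmod /plane_rotation /=.
have -> : p.1 ^+ 2 + p.2 ^+ 2 = (c ^+ 2 + s ^+ 2) * (p.1 ^+ 2 + p.2 ^+ 2).
  by rewrite cs mul1r.
by ring.
Qed.

Lemma plane_disk_rotation c s : c ^+ 2 + s ^+ 2 = 1 ->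
  plane_rotation c s @^-1` D = D.
Proof.
by move=> cs; apply/seteqP; split => p; rewrite /preimage/= !plane_diskE
  sqmod_rotation.
Qed.

Lemma integral_rotation c s u M : s != 0 -> c ^+ 2 + s ^+ 2 = 1 ->
  measurable_fun D u -> (forall p, D p -> `|u p| <= M) ->
  I (u \o plane_rotation c s) = I u.
Proof.
move=> s0 cs mu uM; have mD := @measurable_plane_disk R.
have rotD p : D p -> D (plane_rotation c s p).
  by rewrite !plane_diskE sqmod_rotation.
have mrot := @measurable_plane_rotation R c s.
(* Extension by 0: the change of variables asks for a function measurable on the whole plane, while
   [u] is controlled on the disk only. *)
pose f := (EFin \o (fun p => u p * W p)) \_ D.
have mf : measurable_fun [set: TR * TR] f.
  apply/(measurable_restrictT _ mD).
  exact: measurable_int (integrable_weight _ _ mu uM).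
have mur : measurable_fun D (u \o plane_rotation c s).
  apply: (measurable_comp mD _ mu); last exact: measurable_funTS.
  by move=> _ [p Dp <-]; exact: rotD.
have fE p : D p -> f p = (u p * W p)%:E.
  by move=> Dp; rewrite /f patchE mem_set.
have frE p : D p -> f (plane_rotation c s p) =
    ((u \o plane_rotation c s) p * W p)%:E.
  move=> Dp; rewrite fE; last exact: rotD.
  by rewrite !weightE sqmod_rotation.
have ifr : (@dA R).-integrable (plane_rotation c s @^-1` D)
    (f \o plane_rotation c s).
  rewrite (plane_disk_rotation c s cs).
  apply: (@eq_integrable _ _ _ _ _ mD (EFin \o
    (fun p => (u \o plane_rotation c s) p * W p))).
    by move=> p; rewrite inE => Dp; rewrite /= frE.
  apply: (integrable_weight _ M mur) => p Dp; apply: uM.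
  exact: rotD.
have := integral_pushforward mrot mf ifr mD.
rewrite (plane_disk_rotation c s cs) => h.
congr fine; transitivity (\int[@dA R]_(p in D) (f \o plane_rotation c s) p)%E.
  by apply: eq_integral => p; rewrite inE => Dp; rewrite /= frE.
rewrite -h; transitivity (\int[@dA R]_(p in D) f p)%E.
  apply: eq_measure_integral => B mB BD.
  exact: dA_rotation c s B s0 cs mB.
by apply: eq_integral => p; rewrite inE => Dp; rewrite fE.
Qed.

Lemma disk_integral_rotation c s h : s != 0 -> c ^+ 2 + s ^+ 2 = 1 ->
  bounded_measurable h -> CI (fun w => h ((c +i* s) * w)) = CI h.
Proof.
move=> s0 cs [h1 h2 [M hM]].
have e p : (c +i* s) * to_complex p = to_complex (plane_rotation c s p).
  by case: p => x y; rewrite /to_complex /plane_rotation/=; simpc;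
    rewrite [s * x + _]addrC.
congr (_ +i* _).
- rewrite -(integral_rotation _ _ _ M s0 cs h1).
    by apply: eq_Rintegral => p _; rewrite e.
  by move=> p Dp; apply: le_trans (Re_le_cabs _) _; exact: hM.
- rewrite -(integral_rotation _ _ _ M s0 cs h2).
    by apply: eq_Rintegral => p _; rewrite e.
  by move=> p Dp; apply: le_trans (Im_le_cabs _) _; exact: hM.
Qed.

Lemma cis_exp (t : R) n :
  (cos t +i* sin t) ^+ n = cos (n%:R * t) +i* sin (n%:R * t).
Proof.
elim: n => [|n IH]; first by rewrite expr0 mul0r cos0 sin0.
by rewrite exprS IH -natr1 mulrDl mul1r addrC cosD sinD; simpc;
  congr (_ +i* _); ring.
Qed.

Lemma bounded_measurable_monomial n m :
  bounded_measurable (fun w : C => w ^+ n * w^*%C ^+ m).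
Proof.
apply: bounded_measurableM; first exact: bounded_measurableX
  bounded_measurable_id.
apply: bounded_measurableX; exact: bounded_measurable_conj
  bounded_measurable_id.
Qed.

(** Rotating w by a unimodular u multiplies the integral by u^n conj(u)^m without changing it, so it
    vanishes as soon as that factor differs from 1. *)
Lemma disk_integral_monomial_neq n m : n != m ->
  CI (fun w => w ^+ n * w^*%C ^+ m) = 0.
Proof.
(* Subtraction is truncated and one summand is 0, so k = |n - m|. *)
move=> nm; pose k := ((n - m) + (m - n))%N.
have k0 : (0 < k)%N by rewrite /k; case: (ltngtP n m) nm => // h _;
  rewrite addn_gt0 !subn_gt0 h ?orbT.
(* This angle gives u^k = i, so the factor is i or -i. It lies in ]0, pi[, hence sin t is nonzero,
   as the decomposition into shears requires. *)
pose t : R := pi / 2 / k%:R.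
have t0 : 0 < t by rewrite !divr_gt0 ?pi_gt0 ?ltr0n.
have tpi : t < pi.
  rewrite ltr_pdivrMr ?ltr0n// ltr_pdivrMr// -mulrA -[ltLHS]mulr1.
  rewrite ltr_pM2l ?pi_gt0// -natrM ltr1n.
  by rewrite muln2 -addnn -[2%N]/(1 + 1)%N leq_add.
pose u := cos t +i* sin t.
have s0 : sin t != 0 by rewrite gt_eqF// sin_gt0_pi// t0.
have cs : cos t ^+ 2 + sin t ^+ 2 = 1 by rewrite cos2Dsin2.
have uu : u * u^*%C = 1.
  rewrite /u; simpc; rewrite -!expr2 cs [X in _ +i* X](_ : _ = 0) //; ring.
have uk : u ^+ k = 'i%C.
  rewrite /u cis_exp /t mulrCA divff ?pnatr_eq0 -?lt0n// mulr1.
  by rewrite cos_pihalf sin_pihalf.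
have := disk_integral_rotation _ _ _ s0 cs (bounded_measurable_monomial n m).
rewrite -/u (disk_integral_ext _ (fun w =>
  (u ^+ n * u^*%C ^+ m) * (w ^+ n * w^*%C ^+ m))); last first.
  by move=> w _; rewrite rmorphM !exprMn; ring.
rewrite disk_integralZ; last exact: bounded_measurable_monomial.
set X := CI _ => h.
have un1 : u ^+ n * u^*%C ^+ m != 1.
  have [mn|mn|nm'] := ltngtP n m; last by rewrite nm' eqxx in nm.
  - have -> : u ^+ n * u^*%C ^+ m = (u ^+ k)^*%C.
      rewrite /k (eqP (ltnW mn : n - m == 0)%N) add0n -{1}(subnKC (ltnW mn))
        exprD mulrA.
      by rewrite -exprMn uu expr1n mul1r rmorphXn.
    by rewrite uk eq_complex/= eq_sym oner_eq0.
  - have -> : u ^+ n * u^*%C ^+ m = u ^+ k.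
      rewrite /k (eqP (ltnW mn : m - n == 0)%N) addn0 -{1}(subnKC (ltnW mn))
        exprD.
      by rewrite mulrAC -exprMn uu expr1n mul1r.
    by rewrite uk eq_complex/= eq_sym oner_eq0.
apply/eqP; move/eqP: h; rewrite -subr_eq0 -{2}[X]mul1r -mulrBl mulf_eq0.
by rewrite subr_eq0 (negbTE un1).
Qed.

(** The factor g + 1 of the weight cancels the one in [disk_moment]. What remains is the inverse of
    the n-th Taylor coefficient of (1 - z)^-(g+2), which is why that series reproduces monomials. *)
Lemma disk_integral_monomial_eq n :
  CI (fun w => w ^+ n * w^*%C ^+ n) = ((binc (g + 2) n)^-1)%:C.
Proof.
have e (p : R * R) : to_complex p ^+ n * (to_complex p)^*%C ^+ n =
    (sqmod p ^+ n)%:C.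
  rewrite -exprMn real_complexX; congr (_ ^+ n).
  by case: p => x y; rewrite /to_complex /sqmod /=; simpc;
    rewrite !expr2 [X in _ +i* X](_ : _ = 0)//; ring.
congr (_ +i* _).
  rewrite (@eq_Rintegral _ _ _ _ _ (fun p =>
    (g + 1) * (sqmod p ^+ n * (1 - sqmod p) `^ g))); last first.
    by move=> p _; rewrite e weightE /=; ring.
  rewrite RintegralZl.
  - rewrite disk_moment// invfM mulrA divff ?mul1r//.
  - exact: measurable_plane_disk.
  - apply: (@integrable_bounded_onem_sqmod _ (fun p => sqmod p ^+ n) g 1) =>
    [//||p];
    [exact: measurable_fun_sqmodX|exact: sqmodX_le1].
rewrite (@eq_Rintegral _ _ _ _ _ (fun p => 0)); last by move=> p _;
  rewrite e /= mul0r.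
by rewrite Rintegral_cst ?mul0r//; exact: measurable_plane_disk.
Qed.

End DiskIntegralTheory.

(** * The reproducing property *)

Section UniformPolynomials.
Context {R : realType}.
Local Open Scope classical_set_scope.
Local Open Scope complex_scope.
Local Notation C := R[i].
Implicit Types (f h : C -> C) (e r p M : R) (n N : nat) (z w : C).

(** The classical disk algebra, seen on the open disk. Its members are bounded, so it is closed
    under products and lies in [bounded_measurable]. *)
Definition disk_algebra f : Prop := forall e, 0 < e ->
  exists q : {poly C}, forall w, unit_disk w -> cabs (f w - q.[w]) <= e.

Lemma poly_bounded (q : {poly C}) :
  exists2 M, 0 <= M & forall w, unit_disk w -> cabs q.[w] <= M.
Proof.
exists (\sum_(i < size q) cabs q`_i); first by apply: sumr_ge0 => i _;
  exact: cabs_ge0.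
move=> w w1; rewrite horner_coef; apply: le_trans (cabs_sum _ _ _ _) _.
apply: ler_sum => i _; rewrite cabsM cabsX ler_piMr ?cabs_ge0//.
by rewrite exprn_ile1 ?cabs_ge0// ltW.
Qed.

Lemma disk_algebra_bounded f : disk_algebra f ->
  exists2 M, 0 <= M & forall w, unit_disk w -> cabs (f w) <= M.
Proof.
move=> /(_ 1 ltr01)[q fq]; have [M M0 qM] := poly_bounded q.
exists (1 + M); first by rewrite addr_ge0.
move=> w w1; rewrite -[f w](subrK q.[w]).
by apply: le_trans (cabsD _ _) _; apply: lerD; [exact: fq|exact: qM].
Qed.

Lemma disk_algebra_limit f : (forall e, 0 < e -> exists2 h, disk_algebra h &
    forall w, unit_disk w -> cabs (f w - h w) <= e) -> disk_algebra f.
Proof.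
move=> fh e e0; have e20 : 0 < e / 2 by rewrite divr_gt0.
have [h hA hf] := fh _ e20; have [q hq] := hA _ e20.
exists q => w w1; rewrite -[f w](subrK (h w)) -addrA.
apply: le_trans (cabsD _ _) _; rewrite [leRHS]splitr.
by apply: lerD; [exact: hf|exact: hq].
Qed.

Lemma disk_algebraD f h : disk_algebra f -> disk_algebra h ->
  disk_algebra (fun w => f w + h w).
Proof.
move=> fA hA e e0; have e20 : 0 < e / 2 by rewrite divr_gt0.
have [q fq] := fA _ e20; have [s hs] := hA _ e20.
exists (q + s) => w w1; rewrite hornerD opprD addrACA.
apply: le_trans (cabsD _ _) _; rewrite [leRHS]splitr.
by apply: lerD; [exact: fq|exact: hs].
Qed.

Lemma disk_algebraM f h : disk_algebra f -> disk_algebra h ->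
  disk_algebra (fun w => f w * h w).
Proof.
move=> fA hA e e0.
have [M M0 hM] := disk_algebra_bounded _ hA.
have [q fq] := fA (e / 2 / (1 + M)) ltac:(by rewrite !divr_gt0// ltr_pwDl).
have [N N0 qN] := poly_bounded q.
(* The tolerance depends on the bound N of the polynomial [q], which must therefore be chosen before
   [s]. Adding 1 keeps the divisors positive. *)
have [s hs] := hA (e / 2 / (1 + N)) ltac:(by rewrite !divr_gt0// ltr_pwDl).
exists (q * s) => w w1; rewrite hornerM.
have -> : f w * h w - q.[w] * s.[w] =
    (f w - q.[w]) * h w + q.[w] * (h w - s.[w]).
  by ring.
apply: le_trans (cabsD _ _) _; rewrite [leRHS]splitr !cabsM; apply: lerD.
- apply: (@le_trans _ _ (e / 2 / (1 + M) * (1 + M))).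
    apply: ler_pM; rewrite ?cabs_ge0//; first exact: fq.
    by apply: le_trans (hM _ w1) _; rewrite lerDr.
  by rewrite divfK// gt_eqF// ltr_pwDl.
- apply: (@le_trans _ _ ((1 + N) * (e / 2 / (1 + N)))).
    apply: ler_pM; rewrite ?cabs_ge0//; last exact: hs.
    by apply: le_trans (qN _ w1) _; rewrite lerDr.
  by rewrite mulrC divfK// gt_eqF// ltr_pwDl.
Qed.

Lemma disk_algebra_cst (a : C) : disk_algebra (fun=> a).
Proof. by move=> e e0; exists a%:P => w _; rewrite hornerC subrr cabs0 ltW. Qed.

Lemma disk_algebra_id : disk_algebra id.
Proof. by move=> e e0; exists 'X => w _; rewrite hornerX subrr cabs0 ltW. Qed.

Lemma disk_algebraX f n : disk_algebra f -> disk_algebra (fun w => f w ^+ n).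
Proof.
move=> fA; elim: n => [|n IH].
  by under eq_fun do rewrite expr0; exact: disk_algebra_cst.
by under eq_fun do rewrite exprS; exact: disk_algebraM.
Qed.

Lemma disk_algebra_sum (F : nat -> C -> C) n : (forall i, disk_algebra (F i)) ->
  disk_algebra (fun w => \sum_(i < n) F i w).
Proof.
move=> FA; elim: n => [|n IH].
  by under eq_fun do rewrite big_ord0; exact: disk_algebra_cst.
by under eq_fun do rewrite big_ord_recr/=; exact: disk_algebraD.
Qed.

Lemma bounded_measurable_poly (q : {poly C}) : bounded_measurable (horner q).
Proof.
rewrite (_ : horner q = fun w => \sum_(i < size q) q`_i * w ^+ i); last first.
  by apply/funext => w; rewrite horner_coef.
apply: (bounded_measurable_sum (fun i w => q`_i * w ^+ i)) => i.
apply: bounded_measurableM; first exact: bounded_measurable_cst.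
exact: bounded_measurableX bounded_measurable_id.
Qed.

Lemma disk_algebra_bounded_measurable f :
  disk_algebra f -> bounded_measurable f.
Proof.
move=> fA.
have e0 n : (0 : R) < n.+1%:R^-1 by rewrite invr_gt0 ltr0n.
have /choice[q qf] : forall n, exists q : {poly C},
    forall w, unit_disk w -> cabs (f w - q.[w]) <= n.+1%:R^-1.
  by move=> n; exact: fA.
apply: (@bounded_measurable_limit _ (fun n => horner (q n)) f
  (fun n => n.+1%:R^-1)).
- by move=> n; exact: bounded_measurable_poly.
- by move=> n w w1; rewrite cabs_distC; exact: qf.
- exact: cvg_harmonic.
Qed.

(** The bound of [binsum_bound], divided by the lower bound (1 - r)^p of |1 - z|^p. *)
Definition binsum_err p r N : R :=
  2 * (2 `^ p / (1 - r) * ((N%:R + p) * binc p N * r ^+ N)) / (1 - r) `^ p.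

Lemma binsum_err_cvg p r : 0 < p -> 0 <= r < 1 ->
  binsum_err p r N @[N --> \oo] --> 0.
Proof.
move=> p0 r01; pose K := 2 * (2 `^ p / (1 - r)) / (1 - r) `^ p.
rewrite (_ : binsum_err p r = fun N => (N%:R + p) * binc p N * r ^+ N * K).
  by rewrite -(mul0r K); apply: cvgMl; exact: binsum_err_cvg0.
by apply/funext => N; rewrite /binsum_err /K; ring.
Qed.

Lemma inv_cpow_binsum p r N z : 0 < p -> r < 1 -> cabs z <= r ->
  cabs ((cpow (1 - z) p)^-1 - binsum p N.+1 z) <= binsum_err p r N.
Proof.
move=> p0 r1 zr; have h := binsum_bound _ _ N _ p0 r1 zr.
have z0 := oneB_neq0 _ (le_lt_trans zr r1).
have -> : (cpow (1 - z) p)^-1 - binsum p N.+1 z =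
    - (cpow (1 - z) p * binsum p N.+1 z - 1) / cpow (1 - z) p.
  by field; exact: cpow_neq0.
rewrite cabsM cabsN cabsV cabs_cpow//.
have r0 : 0 < 1 - r by rewrite subr_gt0.
apply: ler_pM; rewrite ?cabs_ge0 ?invr_ge0 ?powR_ge0//.
rewrite lef_pV2 ?posrE ?powR_gt0 ?cabs_gt0//.
apply: ge0_ler_powR; rewrite ?nnegrE ?cabs_ge0 ?(ltW r0) ?(ltW p0)//.
by apply: le_trans (cabs1B_ge _); rewrite lerB.
Qed.

End UniformPolynomials.

Definition disk_kernel {R : realType} (p : R) (xi w : R[i]) : R[i] :=
  (cpow (1 - xi^*%C * w) p)^-1.

(** * Reproduction of monomials, then of their uniform limits *)

Section Reproducing.
Context {R : realType} (g : R).
Hypothesis g1 : -1 < g.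
Local Open Scope classical_set_scope.
Local Open Scope complex_scope.
Local Notation C := R[i].
Local Notation CI := (disk_integral g).
Implicit Types (f h : C -> C) (e r M : R) (n N : nat) (z w xi : C).

Local Notation p := (g + 2).
Let p_gt0 : 0 < p.
Proof. by rewrite -ltrBlDr sub0r; apply: lt_trans g1; rewrite ltrN2 ltr1n. Qed.

Local Notation kernel := (disk_kernel p).

(** Since |conj(xi) f(w)| <= |xi| < 1 for all w in the disk, the binomial series in conj(xi) f(w)
    converges uniformly. *)
Lemma disk_algebra_kernel_comp f xi : unit_disk xi -> disk_algebra f ->
  (forall w, unit_disk w -> unit_disk (f w)) ->
  disk_algebra (fun w => kernel xi (f w)).
Proof.
move=> xi1 fA fD; apply: disk_algebra_limit => e e0.
have r01 : 0 <= cabs xi < 1 by rewrite cabs_ge0.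
have := binsum_err_cvg _ _ p_gt0 r01.
move/cvgrPdist_le => /(_ _ e0)[N _ /(_ N (leqnn N))].
rewrite sub0r normrN => eN.
exists (fun w => binsum p N.+1 (xi^*%C * f w)).
  apply: (disk_algebra_sum (fun n w => (binc p n)%:C * (xi^*%C * f w) ^+ n))
    => n.
  apply: disk_algebraM; first exact: disk_algebra_cst.
  apply: disk_algebraX; apply: disk_algebraM => //; exact: disk_algebra_cst.
move=> w w1; apply: le_trans (le_trans (ler_norm _) eN).
apply: inv_cpow_binsum => //.
by rewrite cabsM cabs_conj ler_piMr ?cabs_ge0// ltW//; exact: fD.
Qed.

Lemma disk_algebra_kernel xi : unit_disk xi -> disk_algebra (kernel xi).
Proof.
move=> xi1; exact: (disk_algebra_kernel_comp id xi xi1 disk_algebra_id).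
Qed.

Lemma cabs_le_eps0 z M : 0 <= M ->
  (forall e, 0 < e -> cabs z <= M * e) -> z = 0.
Proof.
move=> M0 zM; apply/eqP; rewrite -cabs_eq0 eq_le cabs_ge0 andbT.
apply/ler_addgt0Pl => e e0; rewrite addr0.
apply: le_trans (zM (e / (1 + M)) _) _; first by rewrite divr_gt0// ltr_pwDl.
rewrite mulrCA ler_piMr ?(ltW e0)// ler_pdivrMr ?ltr_pwDl// mul1r.
by rewrite lerDr.
Qed.

(** With a partial sum in place of the kernel, orthogonality leaves the term of index n alone, whose
    coefficient cancels the squared norm of w^n. The remainder is uniformly small. *)
Lemma reproducing_monomial xi n : unit_disk xi ->
  CI (fun w => w ^+ n * (kernel xi w)^*%C) = xi ^+ n.
Proof.
move=> xi1; apply/eqP; rewrite -subr_eq0; apply/eqP.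
have bw : bounded_measurable (fun w : C => w ^+ n).
  exact: bounded_measurableX bounded_measurable_id.
have bk := disk_algebra_bounded_measurable _ (disk_algebra_kernel _ xi1).
have bm := @bounded_measurable_monomial R n.
apply: (@cabs_le_eps0 _ 2) => // e e0.
have r01 : 0 <= cabs xi < 1 by rewrite cabs_ge0.
have := binsum_err_cvg _ _ p_gt0 r01.
move/cvgrPdist_le => /(_ _ e0)[N0 _ HN].
(* At least n, so that the one surviving term belongs to the sum. *)
pose N := maxn N0 n.
have := HN N (leq_maxl _ _); rewrite sub0r normrN => eN {HN}.
pose F m (w : C) : C := (binc p m)%:C * xi ^+ m * (w ^+ n * w^*%C ^+ m).
have bF m : bounded_measurable (F m).
  by apply: bounded_measurableM; [exact: bounded_measurable_cst|exact: bm].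
have -> : xi ^+ n = CI (fun w => \sum_(m < N.+1) F m w).
  rewrite disk_integral_sum//.
  have nN : (n < N.+1)%N by rewrite ltnS leq_maxr.
  rewrite (bigD1 (Ordinal nN))//= big1 ?addr0 => [|m mn].
    rewrite disk_integralZ// disk_integral_monomial_eq// mulrAC.
    rewrite -real_complexM divff ?mul1r// gt_eqF//; exact: binc_gt0.
  rewrite disk_integralZ// disk_integral_monomial_neq ?mulr0//.
  by apply: contraNneq mn => nm; apply/eqP/val_inj.
have -> : CI (fun w => w ^+ n * (kernel xi w)^*%C) -
    CI (fun w => \sum_(m < N.+1) F m w)
   = CI (fun w => w ^+ n * (kernel xi w)^*%C + (-1) * \sum_(m < N.+1) F m w).
  rewrite disk_integralD//.
  - by rewrite disk_integralZ ?mulN1r//; exact: bounded_measurable_sum.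
  - by apply: bounded_measurableM => //; exact: bounded_measurable_conj.
  - apply: bounded_measurableM; first exact: bounded_measurable_cst.
    exact: bounded_measurable_sum.
apply: disk_integral_le => //.
  apply: bounded_measurableD.
    by apply: bounded_measurableM => //; exact: bounded_measurable_conj.
  apply: bounded_measurableM; first exact: bounded_measurable_cst.
  exact: bounded_measurable_sum.
move=> w w1.
have -> : \sum_(m < N.+1) F m w = w ^+ n * (binsum p N.+1 (xi^*%C * w))^*%C.
  rewrite /binsum rmorph_sum mulr_sumr; apply: eq_bigr => m _.
  rewrite [X in _ = _ * X](_ : _ = (binc p m)%:C * (xi * w^*%C) ^+ m);
    last by rewrite rmorphM rmorphXn/= rmorphM/= conjcK oppr0.
  by rewrite /F exprMn; ring.
rewrite mulN1r -mulrBr -rmorphB cabsM cabs_conj cabsX.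
apply: (@le_trans _ _ (1 * e)); last by rewrite mul1r.
apply: ler_pM; rewrite ?cabs_ge0 ?exprn_ge0 ?cabs_ge0//.
  by rewrite exprn_ile1 ?cabs_ge0// ltW.
apply: le_trans (le_trans (ler_norm _) eN).
apply: inv_cpow_binsum => //.
by rewrite cabsM cabs_conj ler_piMr ?cabs_ge0// ltW.
Qed.

Lemma reproducing f xi : unit_disk xi -> disk_algebra f ->
  CI (fun w => f w * (kernel xi w)^*%C) = f xi.
Proof.
move=> xi1 fA; apply/eqP; rewrite -subr_eq0; apply/eqP.
have bf := disk_algebra_bounded_measurable _ fA.
have kA := disk_algebra_kernel _ xi1.
have bk := bounded_measurable_conj _ (disk_algebra_bounded_measurable _ kA).
have [M M0 kM] := disk_algebra_bounded _ kA.
(* Replacing f by a polynomial within e costs 2 M e in the integral and e in the value at xi. *)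
apply: (@cabs_le_eps0 _ (2 * M + 1)); first by rewrite addr_ge0 ?mulr_ge0.
move=> e e0; have [q fq] := fA _ e0.
have bq := bounded_measurable_poly q.
have qE : CI (fun w => q.[w] * (kernel xi w)^*%C) = q.[xi].
  pose F i (w : C) := q`_i * (w ^+ i * (kernel xi w)^*%C).
  have bw i : bounded_measurable (fun w : C => w ^+ i * (kernel xi w)^*%C).
    apply: bounded_measurableM => //.
    exact: bounded_measurableX bounded_measurable_id.
  have bF i : bounded_measurable (F i).
    by apply: bounded_measurableM => //; exact: bounded_measurable_cst.
  transitivity (CI (fun w => \sum_(i < size q) F i w)).
    apply: disk_integral_ext => w _; rewrite horner_coef mulr_suml.
    by apply: eq_bigr => i _; rewrite /F mulrA.
  rewrite disk_integral_sum// horner_coef; apply: eq_bigr => i _.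
  by rewrite disk_integralZ// reproducing_monomial.
have -> : CI (fun w => f w * (kernel xi w)^*%C) - f xi =
    CI (fun w => (f w + (-1) * q.[w]) * (kernel xi w)^*%C) - (f xi - q.[xi]).
  rewrite (disk_integral_ext _
    (fun w => (f w + (-1) * q.[w]) * (kernel xi w)^*%C)
    (fun w => f w * (kernel xi w)^*%C + (-1) * (q.[w] * (kernel xi w)^*%C))).
    rewrite disk_integralD ?disk_integralZ ?qE//; first by ring.
    - exact: bounded_measurableM.
    - exact: bounded_measurableM.
    - apply: bounded_measurableM; first exact: bounded_measurable_cst.
      exact: bounded_measurableM.
  by move=> w _; ring.
apply: le_trans (cabsD _ _) _; rewrite cabsN mulrDl mul1r -mulrA; apply: lerD.
- apply: disk_integral_le => //.
    apply: bounded_measurableM => //; apply: bounded_measurableD => //.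
    by apply: bounded_measurableM => //; exact: bounded_measurable_cst.
  move=> w w1; rewrite cabsM cabs_conj mulrC mulN1r.
  by apply: ler_pM; rewrite ?cabs_ge0//; [exact: kM|exact: fq].
- exact: fq.
Qed.

End Reproducing.

(** * The Berezin transform *)

Section BerezinTransform.
Context {R : realType} (g : R) (beta : R[i]).
Hypotheses (g1 : -1 < g) (hbeta : unit_disk beta).
Local Open Scope classical_set_scope.
Local Open Scope complex_scope.
Local Notation C := R[i].
Local Notation psi := (disk_moebius beta).
Implicit Types (z w xi : C).

Lemma conj_mul_lt1 z w : unit_disk z -> unit_disk w -> cabs (z^*%C * w) < 1.
Proof. by move=> z1 w1; apply: cabsM_lt1; rewrite ?cabs_conj. Qed.

Lemma moebius_den_neq0 w : unit_disk w -> 1 - beta^*%C * w != 0.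
Proof. by move=> w1; apply: oneB_neq0; exact: conj_mul_lt1. Qed.

Lemma unit_disk_moebius w : unit_disk w -> unit_disk (psi w).
Proof.
move=> w1; have d0 := moebius_den_neq0 w w1.
rewrite /unit_disk/= /disk_moebius cabsM cabsV ltr_pdivrMr ?cabs_gt0// mul1r.
rewrite -(@ltr_pXn2r _ 2) ?nnegrE ?cabs_ge0// -subr_gt0.
have -> : cabs (1 - beta^*%C * w) ^+ 2 - cabs (w - beta) ^+ 2 =
    (1 - cabs beta ^+ 2) * (1 - cabs w ^+ 2).
  rewrite !cabs_sqr; case: (beta) (w) => a b [x y] /=; ring.
by apply: mulr_gt0; rewrite subr_gt0 expr_lt1 ?cabs_ge0.
Qed.

(** The inverse of the denominator is a geometric series of ratio conj(beta) w, bounded by |beta| <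
    1 uniformly on the disk. *)
Lemma disk_algebra_moebius : disk_algebra psi.
Proof.
apply: disk_algebraM.
  by apply: disk_algebraD; [exact: disk_algebra_id|exact: disk_algebra_cst].
apply: disk_algebra_limit => e e0.
pose b := cabs beta.
have b1 : 0 < 1 - b by rewrite subr_gt0.
have b0 : 0 <= b := cabs_ge0 beta.
have := @cvg_expr R b; rewrite ger0_norm// => /(_ hbeta).
(* The factor 1 - b anticipates the division of the remainder z^N by 1 - z. *)
move/cvgrPdist_le => /(_ (e * (1 - b))) []; first by rewrite mulr_gt0.
move=> N _ /(_ N (leqnn N)); rewrite sub0r normrN => eN.
exists (fun w => \sum_(i < N) (beta^*%C * w) ^+ i).
  apply: (disk_algebra_sum (fun i w => (beta^*%C * w) ^+ i)) => i.
  apply: disk_algebraX; apply: disk_algebraM; last exact: disk_algebra_id.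
  exact: disk_algebra_cst.
move=> w w1; have d0 := moebius_den_neq0 w w1.
have bw : cabs (beta^*%C * w) <= b.
  by rewrite cabsM cabs_conj ler_piMr// ltW.
set z := beta^*%C * w in d0 bw *.
have -> : (1 - z)^-1 - \sum_(i < N) z ^+ i = z ^+ N / (1 - z).
  have := subrX1 z N.
  rewrite -opprB -[z - 1]opprB mulNr => /oppr_inj h.
  by apply: (mulIf d0); rewrite mulrBl mulVf// divfK// mulrC -h opprB addrC
    subrK.
rewrite cabsM cabsV cabsX ler_pdivrMr ?cabs_gt0//.
apply: (@le_trans _ _ (b ^+ N)); first by rewrite lerXn2r// nnegrE cabs_ge0.
apply: le_trans (ler_norm _) _; apply: le_trans eN _.
apply: ler_wpM2l; first exact: ltW.
by apply: le_trans (cabs1B_ge z); rewrite lerB.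
Qed.

Lemma berezin_composition xi : unit_disk xi ->
  berezin g (composition psi) xi =
  ((1 - cabs xi ^+ 2) `^ (g + 2))%:C / cpow (1 - xi^*%C * psi xi) (g + 2).
Proof.
move=> xi1; set c := (1 - cabs xi ^+ 2) `^ ((g + 2) / 2).
have fA := disk_algebra_kernel_comp g g1 _ _ xi1 disk_algebra_moebius
  unit_disk_moebius.
have bf := disk_algebra_bounded_measurable _ fA.
have bk := bounded_measurable_conj _
  (disk_algebra_bounded_measurable _ (disk_algebra_kernel g g1 _ xi1)).
(* The real normalizing factor occurs once in each argument of the inner product; its square
   restores the exponent g + 2. *)
rewrite /berezin /inner (disk_integral_ext _ _ (fun w => (c ^+ 2)%:C *
    (disk_kernel (g + 2) xi (psi w) * (disk_kernel (g + 2) xi w)^*%C)));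
      last first.
  move=> w w1; rewrite -[LHS]/(c%:C * disk_kernel (g + 2) xi (psi w) *
    (c%:C * disk_kernel (g + 2) xi w)^*%C).
  by rewrite conjcM conjc_real real_complexX; ring.
rewrite disk_integralZ//; last exact: bounded_measurableM.
rewrite reproducing//; congr (_%:C * _).
rewrite /c -powR_mulrn ?powR_ge0// -powRrM divfK// pnatr_eq0//.
Qed.

(** Over the common denominator the cross term conj(xi) beta appears, which is the conjugate of
    conj(beta) xi. The difference is left as conj z - z, a form on which conjugation acts
    directly. *)
Lemma moebius_den xi : unit_disk xi ->
  1 - xi^*%C * psi xi =
  ((1 - cabs xi ^+ 2)%:C + ((beta^*%C * xi)^*%C - beta^*%C * xi)) /
  (1 - beta^*%C * xi).
Proof.
move=> xi1; have d0 := moebius_den_neq0 xi xi1.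
have e : (cabs xi ^+ 2)%:C = xi^*%C * xi.
  rewrite cabs_sqr; case: (xi) => x y /=; simpc.
  by rewrite [X in _ +i* X](_ : _ = 0) ?expr2//; ring.
rewrite real_complexD [(- _)%:C]rmorphN/= e conjcM conjcK.
by rewrite /disk_moebius; field.
Qed.

(** By [moebius_den], conjugating z at fixed |xi| conjugates the base of the power; that base lies
    in the right half-plane, where [cpow_conj] applies. *)
Lemma berezin_conj xi xi' : unit_disk xi -> cabs xi' = cabs xi ->
  beta^*%C * xi' = (beta^*%C * xi)^*%C ->
  berezin g (composition psi) xi' = (berezin g (composition psi) xi)^*%C.
Proof.
move=> xi1 ab e; have xi1' : unit_disk xi' by rewrite /unit_disk/= ab.
rewrite !berezin_composition// ab.
have h : 1 - xi'^*%C * psi xi' = (1 - xi^*%C * psi xi)^*%C.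
  rewrite !moebius_den// ab e; set z := beta^*%C * xi.
  rewrite conjcM conjc_inv conjcB conjc1.
  by rewrite conjcD conjc_real conjcB !conjcK.
rewrite h cpow_conj; last first.
  by apply: Re1B_gt0; apply: conj_mul_lt1 => //; exact: unit_disk_moebius.
by rewrite [in RHS]conjcM conjc_inv conjc_real.
Qed.

(** For real z the base of the power is (1 - |xi|^2) / (1 - z), a positive real, and the powers of 1
    - |xi|^2 cancel. *)
Lemma berezin_real xi : unit_disk xi -> complex.Im (beta^*%C * xi) = 0 ->
  berezin g (composition psi) xi =
  ((1 - complex.Re (beta^*%C * xi)) `^ (g + 2))%:C.
Proof.
move=> xi1 im0; rewrite berezin_composition// moebius_den//.
have := conj_mul_lt1 _ _ hbeta xi1.
case: (beta^*%C * xi) im0 => x y /= -> x1.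
have {}x1 : 0 < 1 - x.
  rewrite subr_gt0; apply: le_lt_trans x1.
  exact: le_trans (ler_norm _) (Re_le_cabs (x +i* 0)).
have s0 : 0 < 1 - cabs xi ^+ 2 by rewrite subr_gt0 expr_lt1 ?cabs_ge0.
have -> : ((1 - cabs xi ^+ 2)%:C + ((x -i* 0) - (x +i* 0))) / (1 - (x +i* 0)) =
   ((1 - cabs xi ^+ 2) / (1 - x))%:C.
  rewrite oppr0 subrr addr0 real_complexM; congr (_ * _).
  by rewrite fmorphV rmorphB rmorph1.
rewrite cpow_real ?divr_gt0// -fmorphV -real_complexM; congr (_%:C).
rewrite powRM ?invr_ge0 ?ltW// invfM mulrA divff ?mul1r; last first.
  by rewrite gt_eqF// powR_gt0.
by rewrite -powRN -[(1 - x)^-1]powR_inv1 ?ltW// -powRrM mulrNN mul1r.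
Qed.

Lemma cabs_berezin xi : unit_disk xi -> cabs (berezin g (composition psi) xi) =
  ((1 - cabs xi ^+ 2) / cabs (1 - xi^*%C * psi xi)) `^ (g + 2).
Proof.
move=> xi1; have d0 : 1 - xi^*%C * psi xi != 0.
  by apply: oneB_neq0; apply: conj_mul_lt1 => //; exact: unit_disk_moebius.
have s0 : 0 <= 1 - cabs xi ^+ 2.
  by rewrite subr_ge0 ltW// expr_lt1 ?cabs_ge0.
rewrite berezin_composition// cabsM cabsV cabs_cpow// cabs_real.
rewrite (ger0_norm (powR_ge0 _ _)) powRM ?invr_ge0 ?cabs_ge0//; congr (_ * _).
by rewrite -powRN -[(cabs _)^-1]powR_inv1 ?cabs_ge0// -powRrM mulN1r.
Qed.

End BerezinTransform.

(** * Convexity of the Berezin range *)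

Section BerezinConvexity.
Context {R : realType} (g : R) (beta : R[i]).
Hypotheses (g1 : -1 < g) (hbeta : unit_disk beta).
Local Open Scope classical_set_scope.
Local Open Scope complex_scope.
Local Notation B := (berezin g (composition (disk_moebius beta))).
Let b := cabs beta.
Let b_lt1 : b < 1. Proof. exact: hbeta. Qed.
Let gp_gt0 : 0 < g + 2.
Proof. by rewrite -ltrBlDr sub0r; apply: lt_trans g1; rewrite ltrN2 ltr1n. Qed.

Lemma berezin_range_conj (beta0 : beta != 0) (xi : R[i]) : unit_disk xi ->
  exists2 xi', unit_disk xi' & B xi' = (B xi)^*%C.
Proof.
move=> xi1; have c0 : beta^*%C != 0 by rewrite conjc_eq0.
(* The reflection of xi in the line R beta: conj(beta) xi' = beta conj(xi), and the factor beta /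
   conj(beta) has modulus 1. *)
pose xi' := beta / beta^*%C * xi^*%C.
have ab : cabs xi' = cabs xi.
  by rewrite /xi' !cabsM cabsV !cabs_conj divff ?mul1r// cabs_eq0.
exists xi'; first by rewrite /unit_disk/= ab.
apply: berezin_conj => //.
by rewrite /xi' conjcM conjcK; field.
Qed.

Lemma berezin_real_ge (xi : R[i]) : unit_disk xi ->
  complex.Im (beta^*%C * xi) = 0 ->
  (1 - b) `^ (g + 2) <= complex.Re (B xi).
Proof.
move=> xi1 im0; rewrite berezin_real//.
have h : complex.Re (beta^*%C * xi) <= b.
  apply: le_trans (ler_norm _) (le_trans (Re_le_cabs _) _).
  by rewrite cabsM cabs_conj ler_piMr ?cabs_ge0// ltW.
have b0 : 0 < 1 - b by rewrite subr_gt0.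
have h2 : 1 - b <= 1 - complex.Re (beta^*%C * xi) by rewrite lerB.
apply: ge0_ler_powR => //; rewrite ?nnegrE ?ltW//.
exact: lt_le_trans h2.
Qed.

Lemma berezin_small : beta != 0 -> exists2 xi, unit_disk xi &
  complex.Re (B xi) < (1 - b) `^ (g + 2).
Proof.
move=> beta0; have b0 : 0 < b by rewrite cabs_gt0.
(* This is the value of 1 - |xi|^2 at the chosen point. With a denominator at least t b, the base of
   the power is at most d / (t b) = (1 - b) / (4 t), which is below 1 - b because t >= 1/2. *)
pose d := b * (1 - b) / 4.
have bb : 0 < 1 - b by rewrite subr_gt0.
have d0 : 0 < d by rewrite !(divr_gt0, mulr_gt0).
have d1 : d <= 1 / 4.
  by rewrite ler_pM2r ?invr_gt0//; have := b_lt1; nra.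
pose t := Num.sqrt (1 - d).
have t0 : 0 <= t by exact: sqrtr_ge0.
have t2 : t ^+ 2 = 1 - d by rewrite sqr_sqrtr//; lra.
have th : 1 / 2 <= t by rewrite -(@ler_pXn2r _ 2) ?nnegrE// ?t2 ?expr2; lra.
(* Perpendicular to beta and of modulus t, so that conj(beta) xi = i t b. *)
pose xi := (t / b)%:C * 'i * beta.
have axi : cabs xi = t.
  rewrite !cabsM cabs_real -/b ger0_norm ?divr_ge0// ?(ltW b0)//.
  have -> : cabs ('i : R[i]) = 1 by rewrite cabsE /= expr0n/= expr1n add0r
    sqrtr1.
  by rewrite mulr1 divfK// gt_eqF.
have t1 : t < 1 by rewrite -(@ltr_pXn2r _ 2) ?nnegrE// t2 expr1n; lra.
have xi1 : unit_disk xi by rewrite /unit_disk/= axi.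
exists xi => //.
have zE : beta^*%C * xi = (0 : R) +i* (t * b).
  have -> : beta^*%C * xi = (t / b)%:C * 'i * (beta * beta^*%C) by rewrite /xi;
    ring.
  have -> : beta * beta^*%C = (b ^+ 2)%:C.
    rewrite /b cabs_sqr; case: (beta) => x y /=; simpc.
    by rewrite !expr2 [X in _ +i* X](_ : _ = 0)//; ring.
  rewrite mulrAC -real_complexM; simpc; congr (_ +i* _).
  by field; rewrite gt_eqF.
apply: le_lt_trans (ler_norm _) _; apply: le_lt_trans (Re_le_cabs _) _.
rewrite cabs_berezin// axi t2 (_ : 1 - (1 - d) = d); last by ring.
(* The numerator in [moebius_den] has imaginary part of modulus 2 t b, and |1 - i t b| <= 2. *)
have den : t * b <= cabs (1 - xi^*%C * disk_moebius beta xi).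
  rewrite moebius_den// zE axi t2 cabsM cabsV ler_pdivlMr; last first.
    apply: cabs1B_gt0; rewrite -zE; exact: conj_mul_lt1.
  have n1 : 2 * (t * b) <= cabs ((1 - (1 - d))%:C +
      (((0 : R) +i* (t * b))^*%C - ((0 : R) +i* (t * b)))).
    apply: le_trans (Im_le_cabs _); rewrite /= add0r -opprD normrN ger0_norm;
      first by lra.
    by rewrite addr_ge0// mulr_ge0// ltW.
  apply: le_trans n1; rewrite mulrC ler_wpM2r// ?mulr_ge0 ?(ltW b0)//.
  apply: le_trans (cabsD _ _) _; rewrite cabs1 cabsN.
  have -> : cabs ((0 : R) +i* (t * b)) = t * b.
    by rewrite cabsE /= expr0n/= add0r sqrtr_sqr ger0_norm// mulr_ge0// ltW.
  have := b_lt1; nra.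
apply: gt0_ltr_powR => //; rewrite ?nnegrE ?(ltW bb)//.
  by rewrite mulr_ge0 ?invr_ge0 ?cabs_ge0 ?(ltW d0).
have tb : 0 < t * b by rewrite mulr_gt0//; lra.
rewrite ltr_pdivrMr; last exact: lt_le_trans den.
apply: lt_le_trans (ler_wpM2l (ltW bb) den).
rewrite -subr_gt0 (_ : _ - _ = b * (1 - b) * (t - 1 / 4)); last by rewrite /d;
  field.
by rewrite !mulr_gt0//; lra.
Qed.

Lemma berezin_range_not_convex : beta != 0 ->
  (forall w, unit_disk w -> complex.Im (B w) = 0 ->
    complex.Im (beta^*%C * w) = 0) ->
  ~ real_convex (berezin_range g (composition (disk_moebius beta))).
Proof.
move=> beta0 hreal hconv.
have [xi xi1 small] := berezin_small beta0.
have [xi' xi1' conj] := berezin_range_conj beta0 xi xi1.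
have h0 : 0 <= (2^-1 : R) by lra.
have h1 : (2^-1 : R) <= 1 by lra.
(* Weight 1/2: the midpoint of a value and its conjugate is its real part. *)
have := hconv (B xi) (B xi') (Itv01 h0 h1).
rewrite !inE => /(_ (ex_intro2 _ _ xi xi1 erefl) (ex_intro2 _ _ xi' xi1'
  erefl)).
move=> [eta eta1 etaE].
have midE : B eta = (complex.Re (B xi))%:C.
  rewrite etaE conj.
  (* The convex combination of the alias [Rcomplex R] unfolds to real scalings of the two
     components. *)
  transitivity ((2^-1 *: (B xi : Rcomplex R) +
    (1 - 2^-1) *: ((B xi)^*%C : Rcomplex R)) : R[i]); first by [].
  by case: (B xi) => x y; simpc; congr (_ +i* _) => /=; field.
have := berezin_real_ge eta eta1.
rewrite midE => /(_ (hreal _ eta1 (congr1 (@complex.Im R) midE))).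
by rewrite leNgt small.
Qed.

(** Here z = conj(beta) xi vanishes for every xi, so [berezin_real] gives the constant value 1 and
    the range is a single point. *)
Lemma berezin_range_beta0 : beta = 0 ->
  real_convex (berezin_range g (composition (disk_moebius beta))).
Proof.
move=> beta0.
have B1 xi : unit_disk xi -> B xi = 1.
  move=> xi1; have z0 : beta^*%C * xi = 0 by rewrite beta0 conjc0 mul0r.
  by rewrite berezin_real ?z0// -[complex.Re 0]/(0 : R) subr0 powR1.
move=> x y l; rewrite !inE => -[xi xi1 <-] [eta eta1 <-].
rewrite !B1// convmm; exists 0; last by rewrite B1// /unit_disk/= cabs0.
by rewrite /unit_disk/= cabs0.
Qed.

End BerezinConvexity.

Theorem theorem4p6 (R : realType) (gamma : R) (beta : R[i])
    (hgamma : -1 < gamma) (hbeta : unit_disk beta)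
    (hbounded : bounded_operator gamma (composition (disk_moebius beta)))
    (hreal : forall w : R[i], unit_disk w ->
       complex.Im (berezin gamma (composition (disk_moebius beta)) w) = 0 ->
       complex.Im (beta^*%C * w) = 0) :
  real_convex (berezin_range gamma (composition (disk_moebius beta))) <->
  beta = 0.
Proof.
split=> [hconv|]; last exact: berezin_range_beta0.
apply/eqP/negPn/negP => beta0.
exact: (berezin_range_not_convex _ _ hgamma hbeta beta0 hreal hconv).
Qed.
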